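(* Let $\mathcal C$ be a semisimple strict rigid C*-tensor category with at most countably many isomorphism classes of simple objects, and let $\phi:\mathrm{Irr}(\mathcal C)\to\mathbb C$ be a function, also viewed as the linear functional $[X]\mapsto\phi(X)$ on the fusion algebra $\mathbb C[\mathrm{Irr}(\mathcal C)]\cong\mathcal A_{0,0}$. Then $\phi$ is a weight $0$ annular state if and only if $\phi$ is an admissible state in the sense of Popa--Vaes.
   Context: Categories. $\mathcal C$ is a C*-category with finite-dimensional morphism spaces $Mor(X,Y)$, finite direct sums and subobjects, a strict tensor functor $\otimes$ compatible with $*$, simple tensor unit $id$, duals, and at most countably many isomorphism classes of simple objects. $\mathrm{Irr}(\mathcal C)$ is the set of isomorphism classes of simple objects, $X_k$ a chosen representative of $k\in \mathrm{Irr}(\mathcal C)$, $0$ the class of the unit, $X_0=id$. $d$ is the statistical dimension; $R_\alpha\in Mor(id,\overline \alpha\otimes \alpha)$, $\overline R_\alpha\in Mor(id,\alpha\otimes\overline \alpha)$ are standard solutions of the conjugate equations for an object $\alpha$; $R_k=R_{X_k}$, $\overline R_k=\overline R_{X_k}$, and $\overline X_k$ is identified with $X_{\overline k}$. The fusion algebra $\mathbb C[\mathrm{Irr}(\mathcal C)]$ has basis the classes $[X]$ of simple objects, product given by the fusion rules and $[X]^*=[\overline X]$. Tube algebra. $\mathcal A=\bigoplus_{i,j,k\in \mathrm{Irr}(\mathcal C)}\mathcal A^k_{i,j}$, $\mathcal A^k_{i,j}=Mor(X_k\otimes X_i,X_j\otimes X_k)$, $\mathcal A_{i,j}=\bigoplus_k\mathcal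 A^k_{i,j}$, a $*$-algebra with product $$(x\cdot y)^k_{i,j}=\sum_{s,m,l\in \mathrm{Irr}(\mathcal C)}\ \sum_{V\in onb(X_k,X_m\otimes X_l)}(1_j\otimes V^* )(x^m_{s,j}\otimes 1_l)(1_m\otimes y^l_{i,s})(V\otimes 1_i)$$ and involution $$(x^\#)^k_{i,j}=(\overline R_k^*\otimes 1_j\otimes 1_k)(1_k\otimes (x^{\overline k}_{j,i})^*\otimes 1_k)(1_k\otimes 1_i\otimes R_k),$$ where $onb(X_k,\beta)$ is an orthonormal basis of $Mor(X_k,\beta)$ for the inner product $\eta^*\xi=\langle\xi,\eta\rangle 1_{X_k}$. Put $p_k=1_{X_k}\in\mathcal A^0_{k,k}$. The fusion algebra is identified with $\mathcal A_{0,0}$ via $[X_k]\mapsto 1_{X_k}\in\mathcal A^k_{0,0}$. Weight $0$ annular state: a linear functional $\phi$ on $\mathcal A_{0,0}$ with $\phi(p_0)=1$ and $\phi(f^\#\cdot f)\ge0$ for all $f\in\mathcal A_{0,m}$ and all $m\in \mathrm{Irr}(\mathcal C)$. Multipliers. A multiplier on $\mathcal C$ is a family of linear maps $\Theta_{\alpha,\beta}:End(\alpha\otimes\beta)\to End(\alpha\otimes\beta)$ ($\alpha,\beta\in Obj(\mathcal C)$) such that each $\Theta_{\alpha,\beta}$ is $End(\alpha)\otimes End(\beta)$-bimodular and $\Theta_{\alpha_1\otimes\alpha_2,\beta_1\otimes\beta_2}(1\otimes X\otimes1)=1\otimes\Theta_{\alpha_2,\beta_1}(X)\otimes1$ for all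 objects $\alpha_i,\beta_i$ and $X\in End(\alpha_2\otimes\beta_1)$. It is a cp-multiplier if every $\Theta_{\alpha,\beta}$ is completely positive. Multipliers are in bijection with functions $\psi:\mathrm{Irr}(\mathcal C)\to\mathbb C$ via $\psi\mapsto\Theta^\psi$: for $x\in End(\alpha\otimes\beta)$ let $\hat x=(R_\alpha^*\otimes1_\beta\otimes1_{\overline\beta})(1_{\overline\alpha}\otimes x\otimes1_{\overline\beta})(1_{\overline\alpha\otimes\alpha}\otimes\overline R_\beta)\in Mor(\overline\alpha\otimes\alpha,\beta\otimes\overline\beta)$ (a linear bijection $x\mapsto \hat x$); then $\Theta^\psi_{\alpha,\beta}(x)$ is the unique element with $\widehat{\Theta^\psi_{\alpha,\beta}(x)}=\sum_{k\in \mathrm{Irr}(\mathcal C)}\psi(X_k)\,\hat x\,P^k_{\overline\alpha\alpha}$, where $P^k_{\overline\alpha\alpha}\in End(\overline\alpha\otimes\alpha)$ is the central projection onto the sum of all subobjects isomorphic to $X_k$. The function $\psi$ is called a cp-multiplier if $\Theta^\psi$ is. Admissible state (Popa--Vaes): a function $\phi:\mathrm{Irr}(\mathcal C)\to\mathbb C$, normalized by $\phi(id)=1$, such that $X\mapsto\phi(X)/d(X)$ is a cp-multiplier. *)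

(* Defs.v *)
From HB Require Import structures.
From mathcomp Require Import all_boot all_order all_algebra.
From mathcomp Require Import complex.
From mathcomp Require Import boolp classical_sets functions cardinality.
From mathcomp Require Import fsbigop reals.

Set Implicit Arguments.
Unset Strict Implicit.
Unset Printing Implicit Defensive.

Import Order.TTheory GRing.Theory Num.Theory.
Local Open Scope ring_scope.
Local Open Scope complex_scope.

(* The morphism spaces are finite-dimensional, so they are automatically
   complete for [nrm].  [star_pos] says that [f^* f] is a positive element of
   the C*-algebra [End X]. *)
Record cstarCat (R : realType) := CstarCat {
  obj :> Type;
  Hom : obj -> obj -> vectType R[i];
  idm : forall X, Hom X X;
  comp : forall X Y Z, Hom Y Z -> Hom X Y -> Hom X Z;
  star : forall X Y, Hom X Y -> Hom Y X;
  nrm : forall X Y, Hom X Y -> R;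
  comp1m : forall X Y (f : Hom X Y), comp (idm Y) f = f;
  compm1 : forall X Y (f : Hom X Y), comp f (idm X) = f;
  compA : forall X Y Z W (h : Hom Z W) (g : Hom Y Z) (f : Hom X Y),
    comp h (comp g f) = comp (comp h g) f;
  comp_linearl : forall X Y Z (f : Hom X Y), linear (fun g : Hom Y Z => comp g f);
  comp_linearr : forall X Y Z (g : Hom Y Z), linear (fun f : Hom X Y => comp g f);
  starK : forall X Y (f : Hom X Y), star (star f) = f;
  star_comp : forall X Y Z (g : Hom Y Z) (f : Hom X Y),
    star (comp g f) = comp (star f) (star g);
  star_antilinear : forall X Y (a : R[i]) (f g : Hom X Y),
    star (a *: f + g) = conjc a *: star f + star g;
  nrm_eq0 : forall X Y (f : Hom X Y), nrm f = 0 -> f = 0;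
  nrm_triangle : forall X Y (f g : Hom X Y), nrm (f + g) <= nrm f + nrm g;
  nrm_scale : forall X Y (a : R[i]) (f : Hom X Y),
    (nrm (a *: f))%:C = `|a| * (nrm f)%:C;
  nrm_comp : forall X Y Z (g : Hom Y Z) (f : Hom X Y),
    nrm (comp g f) <= nrm g * nrm f;
  nrm_cstar : forall X Y (f : Hom X Y), nrm (comp (star f) f) = nrm f ^+ 2;
  star_pos : forall X Y (f : Hom X Y),
    exists g : Hom X X, comp (star f) f = comp (star g) g
}.

Arguments idm {R c} X.

Declare Scope cat_scope.
Delimit Scope cat_scope with cat.
Local Open Scope cat_scope.

Notation "f ^#*" := (star f) (at level 2, format "f ^#*") : cat_scope.

Definition recast (R : realType) (C : cstarCat R) (X Y X' Y' : C)
    (f : Hom X Y) (eX : X = X') (eY : Y = Y') : Hom X' Y' :=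
  ecast Z (Hom X' Z) eY (ecast Z (Hom Z Y) eX f).
Arguments recast {R C X Y X' Y'} & f eX eY.

Section CstarCat.
Context {R : realType} {C : cstarCat R}.
Implicit Types X Y : C.

Definition isom X Y : Prop :=
  exists (f : Hom X Y) (g : Hom Y X), comp g f = idm X /\ comp f g = idm Y.

Definition isometry X Y (v : Hom X Y) : Prop := comp (star v) v = idm X.

Definition projection X (p : Hom X X) : Prop := star p = p /\ comp p p = p.

Definition simple X : Prop := \dim (fullv : {vspace Hom X X}) = 1%N.

Definition has_direct_sums : Prop := forall X Y, exists (Z : C)
  (u : Hom X Z) (v : Hom Y Z), [/\ isometry u, isometry v
    & comp u (star u) + comp v (star v) = idm Z].

Definition has_subobjects : Prop := forall X (p : Hom X X), projection p ->
  exists (Y : C) (v : Hom Y X), isometry v /\ comp v (star v) = p.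

(* Positivity in the C*-algebra of n x n matrices over [End X]: [a = b^* b]. *)
Definition mx_positive X (n : nat) (a : 'I_n -> 'I_n -> Hom X X) : Prop :=
  exists b : 'I_n -> 'I_n -> Hom X X,
    forall i j, a i j = \sum_(k < n) comp (star (b k i)) (b k j).

Definition completely_positive X (T : Hom X X -> Hom X X) : Prop :=
  forall n (a : 'I_n -> 'I_n -> Hom X X),
    mx_positive a -> mx_positive (fun i j => T (a i j)).

End CstarCat.

Record tensorCat (R : realType) := TensorCat {
  cat_of :> cstarCat R;
  unit_ob : cat_of;
  tob : cat_of -> cat_of -> cat_of;
  thom : forall X Y X' Y' : cat_of,
    Hom X Y -> Hom X' Y' -> Hom (tob X X') (tob Y Y');
  thom1 : forall X Y : cat_of, thom (idm X) (idm Y) = idm (tob X Y);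
  thom_comp : forall (X Y Z X' Y' Z' : cat_of) (g : Hom Y Z) (f : Hom X Y)
      (g' : Hom Y' Z') (f' : Hom X' Y'),
    thom (comp g f) (comp g' f') = comp (thom g g') (thom f f');
  thom_linearl : forall (X Y X' Y' : cat_of) (g : Hom X' Y'),
    linear (fun f : Hom X Y => thom f g);
  thom_linearr : forall (X Y X' Y' : cat_of) (f : Hom X Y),
    linear (fun g : Hom X' Y' => thom f g);
  thom_star : forall (X Y X' Y' : cat_of) (f : Hom X Y) (g : Hom X' Y'),
    star (thom f g) = thom (star f) (star g);
  tobA : forall X Y Z : cat_of, tob X (tob Y Z) = tob (tob X Y) Z;
  tob1l : forall X : cat_of, tob unit_ob X = X;
  tob1r : forall X : cat_of, tob X unit_ob = X;
  thomA : forall (X Y X' Y' X'' Y'' : cat_of)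
      (f : Hom X Y) (g : Hom X' Y') (h : Hom X'' Y''),
    recast (thom f (thom g h)) (tobA X X' X'') (tobA Y Y' Y'')
      = thom (thom f g) h;
  thom1l : forall (X Y : cat_of) (f : Hom X Y),
    recast (thom (idm unit_ob) f) (tob1l X) (tob1l Y) = f;
  thom1r : forall (X Y : cat_of) (f : Hom X Y),
    recast (thom f (idm unit_ob)) (tob1r X) (tob1r Y) = f;
  unit_simple : simple unit_ob
}.

Notation "X ⊗ Y" := (tob X Y) (at level 40, left associativity) : cat_scope.
Notation "f ⊠ g" := (thom f g) (at level 40, left associativity) : cat_scope.
Notation "'𝟙'" := (unit_ob _) (at level 0) : cat_scope.

(* Objects of a strict tensor category that differ only by bracketing and
   units are equal, but not convertible.  [strict f] transports [f] along such
   equalities, and [g ∘ f] composes up to such equalities.  The equality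
   proofs are irrelevant by [Prop_irrelevance]. *)
Ltac strict_eq := by rewrite ?tobA ?tob1l ?tob1r ?tobA.
Notation "'strict' f" :=
  (recast f ltac:(strict_eq) ltac:(strict_eq))
  (at level 10, f at level 8, only parsing) : cat_scope.
Notation "g ∘ f" := (comp g (recast f erefl ltac:(strict_eq)))
  (at level 50, left associativity, only parsing) : cat_scope.

Section Conjugates.
Context {R : realType} {C : tensorCat R}.
Implicit Types X Y : C.

Definition conjugate_eqs X Y (r : Hom 𝟙 (Y ⊗ X)) (rb : Hom 𝟙 (X ⊗ Y)) : Prop :=
  (strict ((rb^#* ⊠ idm X) ∘ (idm X ⊠ r)) : Hom X X) = idm X /\
  (strict ((r^#* ⊠ idm Y) ∘ (idm Y ⊠ rb)) : Hom Y Y) = idm Y.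

(* Standard solutions in the form used by Popa and Vaes: the left and the right
   functional on [End X] coincide. *)
Definition standard X Y (r : Hom 𝟙 (Y ⊗ X)) (rb : Hom 𝟙 (X ⊗ Y)) : Prop :=
  forall T : Hom X X,
    comp (comp r^#* (idm Y ⊠ T)) r = comp (comp rb^#* (T ⊠ idm Y)) rb.

Definition has_duals : Prop := forall X, exists (Y : C)
  (r : Hom 𝟙 (Y ⊗ X)) (rb : Hom 𝟙 (X ⊗ Y)), conjugate_eqs r rb.

End Conjugates.

Record rigidCstarTensorCat (R : realType) := RigidCstarTensorCat {
  tcat_of :> tensorCat R;
  rigid_direct_sums : has_direct_sums (C := tcat_of);
  rigid_subobjects : has_subobjects (C := tcat_of);
  rigid_duals : has_duals (C := tcat_of)
}.

(* [s] is an orthonormal basis of [Mor(X, Y)], [X] simple, for the inner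
   product given by [star eta * xi = <xi, eta> 1_X]. *)
Definition orthonormal_basis (R : realType) (C : cstarCat R) (X Y : C)
    (s : seq (Hom X Y)) : Prop :=
  basis_of fullv s /\ forall a b, (a < size s)%N -> (b < size s)%N ->
    comp (star s`_a) s`_b = (a == b)%:R *: idm X.

(* [Irr] indexes the isomorphism classes of simple objects, with
   representatives [rep]; [conj_ob X] with [sol X], [solb X] is a standard
   solution of the conjugate equations for [X]; [onb k Y] is an orthonormal
   basis of [Mor(X_k, Y)]. *)
Record choices (R : realType) (C : rigidCstarTensorCat R) := Choices {
  Irr : countType;
  irr0 : Irr;
  rep : Irr -> C;
  rep0 : rep irr0 = 𝟙;
  rep_simple : forall k, simple (rep k);
  rep_inj : forall k l, isom (rep k) (rep l) -> k = l;
  rep_surj : forall X : C, simple X -> exists k, isom X (rep k);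
  conj_ob : C -> C;
  sol : forall X, Hom 𝟙 (conj_ob X ⊗ X);
  solb : forall X, Hom 𝟙 (X ⊗ conj_ob X);
  sol_conj : forall X, conjugate_eqs (sol X) (solb X);
  sol_standard : forall X, standard (sol X) (solb X);
  bar : Irr -> Irr;
  conj_rep : forall k, conj_ob (rep k) = rep (bar k);
  onb : forall k (Y : C), seq (Hom (rep k) Y);
  onbP : forall k Y, orthonormal_basis (onb k Y)
}.

Section TubeAlgebra.
Context {R : realType} {C : rigidCstarTensorCat R} (S : choices C).
Local Notation I := (Irr S).
Local Notation X_ := (rep (c := S)).
Local Notation "k ^b" := (bar k) (at level 2, format "k ^b").
Local Notation o := (irr0 S).
Implicit Types i j k l m s : I.

Definition Rk k : Hom 𝟙 (X_ k^b ⊗ X_ k) :=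
  recast (sol S (X_ k)) erefl (congr1 (fun Z => Z ⊗ X_ k) (conj_rep k)).
Definition Rbk k : Hom 𝟙 (X_ k ⊗ X_ k^b) :=
  recast (solb S (X_ k)) erefl (congr1 (fun Z => X_ k ⊗ Z) (conj_rep k)).

Definition tubeHom i j k := Hom (X_ k ⊗ X_ i) (X_ j ⊗ X_ k).

(* The tube algebra is the space of the finitely supported families; product
   and involution are defined on all families.  [\sum_(t \in A)] is the sum of
   a finitely supported function, which it is for the product of finitely
   supported families. *)
Definition family := forall i j k, tubeHom i j k.

Definition tube_mul (x y : family) : family := fun i j k =>
  \sum_(t \in [set: I * I * I]) let: (s, m, l) := t in
    \sum_(V <- onb k (X_ m ⊗ X_ l))
      ((idm (X_ j) ⊠ V^#* ) ∘ (x s j m ⊠ idm (X_ l))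
        ∘ (idm (X_ m) ⊠ y i s l) ∘ (V ⊠ idm (X_ i))).

Definition tube_inv (x : family) : family := fun i j k =>
  strict ((Rbk k)^#* ⊠ idm (X_ j) ⊠ idm (X_ k)
    ∘ (idm (X_ k) ⊠ (x j i k^b)^#* ⊠ idm (X_ k))
    ∘ (idm (X_ k) ⊠ idm (X_ i) ⊠ Rk k)).

(* Membership in A_{i,j}. *)
Definition in_block i j (x : family) : Prop :=
  finite_set [set k | x i j k != 0] /\
  forall i' j' k, (i', j') != (i, j) -> x i' j' k = 0.

(* The identity of X_k, as an element of A^0_{k,k} and of A^k_{0,0}. *)
Definition tube_id k : tubeHom k k o :=
  recast (idm (X_ k))
    (etrans (esym (tob1l (X_ k))) (congr1 (fun Z => Z ⊗ X_ k) (esym (rep0 S))))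
    (etrans (esym (tob1r (X_ k))) (congr1 (fun Z => X_ k ⊗ Z) (esym (rep0 S)))).
Definition fusion_basis k : tubeHom o o k :=
  recast (idm (X_ k))
    (etrans (esym (tob1r (X_ k))) (congr1 (fun Z => X_ k ⊗ Z) (esym (rep0 S))))
    (etrans (esym (tob1l (X_ k))) (congr1 (fun Z => Z ⊗ X_ k) (esym (rep0 S)))).

Definition tube_proj k : family := fun i' j' k' =>
  dfwith (T := fun t : I * I * I => tubeHom t.1.1 t.1.2 t.2) (fun=> 0)
    (i := (k, k, o)) (tube_id k) (i', j', k').

(* A functional on A_{0,0} takes the (0, 0) block of an element as argument. *)
Definition weight0_annular_state (F : (forall k, tubeHom o o k) -> R[i]) : Prop :=
  [/\ forall (a : R[i]) (x y : family), in_block o o x -> in_block o o y ->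
        F (fun k => a *: x o o k + y o o k) = a * F (x o o) + F (y o o),
      F (tube_proj o o o) = 1
    & forall m (f : family), in_block o m f ->
        0 <= F (tube_mul (tube_inv f) f o o)].

(* A^k_{0,0} is spanned by [fusion_basis k], which stands for [X_k] in the
   fusion algebra: this is the functional [X_k] |-> phi k. *)
Definition fusion_functional (phi : I -> R[i]) (x : forall k, tubeHom o o k) : R[i] :=
  \sum_(k \in [set: I]) phi k * coord [tuple fusion_basis k] ord0 (x k).

End TubeAlgebra.

Section Multipliers.
Context {R : realType} {C : rigidCstarTensorCat R} (S : choices C).
Local Notation I := (Irr S).
Local Notation X_ := (rep (c := S)).
Local Notation R_ := (sol S).
Local Notation Rb_ := (solb S).
Local Notation cj := (conj_ob S).

Definition is_multiplier
    (Th : forall a b : C, Hom (a ⊗ b) (a ⊗ b) -> Hom (a ⊗ b) (a ⊗ b)) : Prop :=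
  [/\ forall a b, linear (Th a b),
      forall a b (f f' : Hom a a) (g g' : Hom b b) (x : Hom (a ⊗ b) (a ⊗ b)),
        Th a b (comp (comp (f ⊠ g) x) (f' ⊠ g'))
          = comp (comp (f ⊠ g) (Th a b x)) (f' ⊠ g')
    & forall a1 a2 b1 b2 (x : Hom (a2 ⊗ b1) (a2 ⊗ b1)),
        Th (a1 ⊗ a2) (b1 ⊗ b2) (strict (idm a1 ⊠ x ⊠ idm b2))
          = strict (idm a1 ⊠ Th a2 b1 x ⊠ idm b2)].

Definition is_cp_multiplier
    (Th : forall a b : C, Hom (a ⊗ b) (a ⊗ b) -> Hom (a ⊗ b) (a ⊗ b)) : Prop :=
  is_multiplier Th /\ forall a b, completely_positive (Th a b).

Definition hat (a b : C) (x : Hom (a ⊗ b) (a ⊗ b)) : Hom (cj a ⊗ a) (b ⊗ cj b) :=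
  strict ((R_ a)^#* ⊠ idm b ⊠ idm (cj b)
    ∘ (idm (cj a) ⊠ x ⊠ idm (cj b))
    ∘ (idm (cj a ⊗ a) ⊠ Rb_ b)).

(* The central projection onto the sum of all subobjects of [Y] isomorphic to
   [X_k], i.e. the smallest projection dominating all of them. *)
Definition is_isotypic (k : I) (Y : C) (p : Hom Y Y) : Prop :=
  [/\ projection p, forall f : Hom Y Y, comp p f = comp f p,
      forall v : Hom (X_ k) Y, isometry v -> comp p v = v
    & forall q : Hom Y Y, projection q ->
        (forall v : Hom (X_ k) Y, isometry v -> comp q v = v) -> comp q p = p].

Definition isotypic (k : I) (Y : C) : Hom Y Y :=
  xget 0 [set p | is_isotypic k p].

Definition Theta (psi : I -> R[i]) (a b : C) (x : Hom (a ⊗ b) (a ⊗ b)) :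
    Hom (a ⊗ b) (a ⊗ b) :=
  xget 0 [set y | hat y =
    \sum_(k \in [set: I]) psi k *: comp (hat x) (isotypic k (cj a ⊗ a))].

Definition cp_multiplier (psi : I -> R[i]) : Prop := is_cp_multiplier (Theta psi).

(* The statistical dimension: [sol X], [solb X] is a standard solution. *)
Definition sdim (X : C) : R := nrm (R_ X) * nrm (Rb_ X).

Definition admissible_state (phi : I -> R[i]) : Prop :=
  phi (irr0 S) = 1 /\ cp_multiplier (fun k => phi k / (sdim (X_ k))%:C).

End Multipliers.

(* Main.v *)
From HB Require Import structures.
From mathcomp Require Import all_boot all_order all_algebra spectral complex.
From mathcomp Require Import boolp classical_sets functions cardinality.
From mathcomp Require Import fsbigop reals ring.
Require Import Defs.

(** For an object [a] with conjugate [ā] and solutions [R], [R̄] of the conjugate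
    equations, Frobenius reciprocity in the left tensor factor turns Theta^psi
    into composition with the natural transformation G = Σ_k psi(k) P^k.  A
    morphism [y : a ⊗ b -> c] factors as [(R̄^† ⊗ 1) (1 ⊗ z)], so complete
    positivity of Theta^psi amounts to positivity of the matrix of
    [T_{12} = Theta(R̄_1 R̄_2^†) : a_2 ⊗ ā_2 -> a_1 ⊗ ā_1] over simple objects
    [a_i].  Testing it on [h_i = (f_i ⊗ 1) R̄_i] with [f_i : a_i -> X_m ⊗ a_i]
    gives the closed diagram [Tr (G (f_1^# ⊗ 1) (1 ⊗ f_2))] on [ā_1 ⊗ a_2].
    Standard solutions make this trace spherical, so the trace of [V V^†] is
    d(X_k) times [V^† V] for [V : X_k -> ā_1 ⊗ a_2].  The factor d(X_k) turns
    psi into phi, and the sum over all pairs is the value of phi on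
    [f^# . f]. *)

Set Implicit Arguments.
Unset Strict Implicit.
Unset Printing Implicit Defensive.

Import Order.TTheory GRing.Theory Num.Theory VectorInternalTheory.
Local Open Scope ring_scope.
Local Open Scope complex_scope.
Local Open Scope cat_scope.

(** * Arrows of a strict tensor category *)

(** Three obstacles shape the argument. Strictness is only a propositional equality of objects, so
    diagrams are handled as arrows with bundled endpoints, on which the tensor laws are plain
    equations. Conjugates are chosen separately for every object, and the one of [a ⊗ b] has no
    given relation to those of [a] and [b]. Theta is therefore rewritten as a map [twist] that
    accepts any solution of the conjugate equations, and two solutions are compared by factoring one
    evaluation through the other. The trace on [ā_1 ⊗ a_2] uses the product of the chosen solutions,
    for which standardness is not given. Its left and right versions agree because partial traces
    over simple factors are scalars; a comparison of positive definite forms then shows that the two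
    transposes of a morphism out of a simple object coincide, and this yields the factor d(X_k).
    Positivity is obtained without functional calculus: projections come from eigenvectors and
    ranks, square roots from the spectral theorem for the scalar matrices on the isotypic
    components. *)

Section LinearMaps.
Context {K : pzRingType} {U V : lmodType K} {L : U -> V} (Llin : linear L).

Lemma lin_add u v : L (u + v) = L u + L v.
Proof. by have := Llin 1 u v; rewrite !scale1r. Qed.
Lemma lin_zero : L 0 = 0.
Proof. by apply: (addrI (L 0)); rewrite -lin_add !addr0. Qed.
Lemma lin_scale a u : L (a *: u) = a *: L u.
Proof. by have := Llin a u 0; rewrite lin_zero !addr0. Qed.
Lemma lin_sub u v : L (u - v) = L u - L v.
Proof. by rewrite -scaleN1r lin_add lin_scale scaleN1r. Qed.
Lemma lin_sum I (r : seq I) P F :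
  L (\sum_(i <- r | P i) F i) = \sum_(i <- r | P i) L (F i).
Proof. exact: (big_morph _ lin_add lin_zero). Qed.

End LinearMaps.

Section CatLinear.
Context {R : realType} {C : cstarCat R}.
Implicit Types X Y Z : C.

Lemma compDl X Y Z (g g' : Hom Y Z) (f : Hom X Y) :
  comp (g + g') f = comp g f + comp g' f.
Proof. exact: (lin_add (comp_linearl f)). Qed.
Lemma compDr X Y Z (g : Hom Y Z) (f f' : Hom X Y) :
  comp g (f + f') = comp g f + comp g f'.
Proof. exact: (lin_add (comp_linearr g)). Qed.
Lemma compBl X Y Z (g g' : Hom Y Z) (f : Hom X Y) :
  comp (g - g') f = comp g f - comp g' f.
Proof. exact: (lin_sub (comp_linearl f)). Qed.
Lemma compBr X Y Z (g : Hom Y Z) (f f' : Hom X Y) :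
  comp g (f - f') = comp g f - comp g f'.
Proof. exact: (lin_sub (comp_linearr g)). Qed.
Lemma comp0m X Y Z (f : Hom X Y) : comp (0 : Hom Y Z) f = 0.
Proof. exact: (lin_zero (comp_linearl f)). Qed.
Lemma compm0 X Y Z (g : Hom Y Z) : comp g (0 : Hom X Y) = 0.
Proof. exact: (lin_zero (comp_linearr g)). Qed.
Lemma compZl X Y Z a (g : Hom Y Z) (f : Hom X Y) :
  comp (a *: g) f = a *: comp g f.
Proof. exact: (lin_scale (comp_linearl f)). Qed.
Lemma compZr X Y Z a (g : Hom Y Z) (f : Hom X Y) :
  comp g (a *: f) = a *: comp g f.
Proof. exact: (lin_scale (comp_linearr g)). Qed.
Lemma comp_suml X Y Z I (r : seq I) P (g : I -> Hom Y Z) (f : Hom X Y) :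
  comp (\sum_(i <- r | P i) g i) f = \sum_(i <- r | P i) comp (g i) f.
Proof. exact: (lin_sum (comp_linearl f)). Qed.
Lemma comp_sumr X Y Z I (r : seq I) P (g : Hom Y Z) (f : I -> Hom X Y) :
  comp g (\sum_(i <- r | P i) f i) = \sum_(i <- r | P i) comp g (f i).
Proof. exact: (lin_sum (comp_linearr g)). Qed.

Lemma star0 X Y : star (0 : Hom X Y) = 0.
Proof.
have := star_antilinear 1 (0 : Hom X Y) 0.
rewrite scaler0 addr0 rmorph1 scale1r => /eqP.
by rewrite -subr_eq0 opprD addrA subrr sub0r oppr_eq0 => /eqP.
Qed.
Lemma starD X Y (f g : Hom X Y) : star (f + g) = star f + star g.
Proof. by have := star_antilinear 1 f g; rewrite rmorph1 !scale1r. Qed.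
Lemma starZ X Y a (f : Hom X Y) : star (a *: f) = conjc a *: star f.
Proof. by have := star_antilinear a f 0; rewrite star0 !addr0. Qed.
Lemma starB X Y (f g : Hom X Y) : star (f - g) = star f - star g.
Proof. by rewrite -scaleN1r starD starZ rmorphN1 scaleN1r. Qed.
Lemma star_sum X Y I (r : seq I) P (f : I -> Hom X Y) :
  star (\sum_(i <- r | P i) f i) = \sum_(i <- r | P i) star (f i).
Proof. exact: (big_morph _ (@starD X Y) (@star0 X Y)). Qed.
Lemma star1 X : star (idm X) = idm X.
Proof. by rewrite -[RHS]starK -[in RHS](comp1m (star (idm X))) star_comp !starK comp1m. Qed.
Lemma star_inj X Y : injective (@star R C X Y).
Proof. by move=> f g /(congr1 (@star _ _ _ _)); rewrite !starK. Qed.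

Lemma nrm0 X Y : nrm (0 : Hom X Y) = 0.
Proof.
have := nrm_scale 0 (0 : Hom X Y).
by rewrite scaler0 normr0 mul0r => -[].
Qed.

Lemma starcomp_eq0 X Y (f : Hom X Y) : comp (star f) f = 0 -> f = 0.
Proof.
move=> e; apply: nrm_eq0; have := nrm_cstar f; rewrite e nrm0 => /esym/eqP.
by rewrite sqrf_eq0 => /eqP.
Qed.

End CatLinear.

Section Arrows.
Context {R : realType} {C : tensorCat R}.
Implicit Types X Y Z : C.

Lemma thom_suml X Y X' Y' I (r : seq I) P (f : I -> Hom X Y) (g : Hom X' Y') :
  (\sum_(i <- r | P i) f i) ⊠ g = \sum_(i <- r | P i) f i ⊠ g.
Proof. exact: (lin_sum (thom_linearl g)). Qed.
Lemma thomZl X Y X' Y' a (f : Hom X Y) (g : Hom X' Y') :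
  (a *: f) ⊠ g = a *: (f ⊠ g).
Proof. exact: (lin_scale (thom_linearl g)). Qed.
Lemma thomZr X Y X' Y' a (f : Hom X Y) (g : Hom X' Y') :
  g ⊠ (a *: f) = a *: (g ⊠ f).
Proof. exact: (lin_scale (thom_linearr g)). Qed.
Lemma thom0l X Y X' Y' (g : Hom X' Y') : (0 : Hom X Y) ⊠ g = 0.
Proof. exact: (lin_zero (thom_linearl g)). Qed.
Lemma thom0r X Y X' Y' (g : Hom X' Y') : g ⊠ (0 : Hom X Y) = 0.
Proof. exact: (lin_zero (thom_linearr g)). Qed.

(** Bundling the endpoints makes [recast] invisible: morphisms between equal but non-convertible
    objects are compared by plain equality. *)
Record arrow := Arr { dom : C; cod : C; mor : Hom dom cod }.

(** A total retraction of [Arr], with the zero morphism as default when the endpoints do not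
    match. *)
Definition typed X Y (t : arrow) : Hom X Y :=
  match pselect (dom t = X), pselect (cod t = Y) with
  | left e, left e' => recast (mor t) e e'
  | _, _ => 0
  end.

Lemma recast_id X Y (f : Hom X Y) (e : X = X) (e' : Y = Y) : recast f e e' = f.
Proof. by rewrite (Prop_irrelevance e erefl) (Prop_irrelevance e' erefl). Qed.

Lemma typed_Arr X Y (f : Hom X Y) : typed X Y (Arr f) = f.
Proof.
by rewrite /typed /=; case: pselect => // e; case: pselect => // e'; rewrite recast_id.
Qed.

Lemma Arr_inj X Y (f g : Hom X Y) : Arr f = Arr g -> f = g.
Proof. by move=> /(congr1 (typed X Y)); rewrite !typed_Arr. Qed.

Lemma Arr_recast X Y X' Y' (f : Hom X Y) (e : X = X') (e' : Y = Y') :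
  Arr (recast f e e') = Arr f.
Proof. by case: _ / e; case: _ / e'. Qed.

Lemma Arr_typed X Y t : dom t = X -> cod t = Y -> Arr (typed X Y t) = t.
Proof. by case: t => X' Y' f /= <- <-; rewrite typed_Arr. Qed.

Lemma typed0 X Y t : (dom t <> X) \/ (cod t <> Y) -> typed X Y t = 0.
Proof.
by rewrite /typed; case: pselect => // e; case: pselect => // e' [].
Qed.

Lemma typed_zero X Y X' Y' : typed X Y (Arr (0 : Hom X' Y')) = 0.
Proof.
have [e|ne] := pselect (X' = X); last by rewrite typed0 //; left.
have [e'|ne] := pselect (Y' = Y); last by rewrite typed0 //; right.
by subst; rewrite typed_Arr.
Qed.

(* A composite of mismatched arrows is the zero morphism, so composition of
   arrows is associative without side conditions. *)
Definition acomp (g f : arrow) : arrow :=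
  Arr (comp (mor g) (typed (dom f) (dom g) f)).
Definition aten (f g : arrow) : arrow := Arr (mor f ⊠ mor g).
Definition astar (f : arrow) : arrow := Arr (star (mor f)).
Definition aid X : arrow := Arr (idm X).
Definition ascale (a : R[i]) (f : arrow) : arrow := Arr (a *: mor f).

End Arrows.

Declare Scope arrow_scope.
Delimit Scope arrow_scope with arrow.
Infix "•" := acomp (at level 40, left associativity) : arrow_scope.
Infix "⊙" := aten (at level 35, right associativity) : arrow_scope.
Notation "f ^*" := (astar f) : arrow_scope.
Local Open Scope arrow_scope.

Section ArrowTheory.
Context {R : realType} {C : tensorCat R}.
Implicit Types (X Y Z : C) (f g h t : arrow (C := C)).

Lemma acomp_mismatch g f : cod f <> dom g -> g • f = Arr (0 : Hom (dom f) (cod g)).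
Proof. by move=> ne; rewrite /acomp typed0 ?compm0 //; right. Qed.

Lemma Arr_comp X Y Z (g : Hom Y Z) (f : Hom X Y) :
  Arr (comp g f) = Arr g • Arr f.
Proof. by rewrite /acomp /= typed_Arr. Qed.
Lemma Arr_thom X Y X' Y' (f : Hom X Y) (g : Hom X' Y') :
  Arr (f ⊠ g) = Arr f ⊙ Arr g.
Proof. by []. Qed.
Lemma Arr_star X Y (f : Hom X Y) : Arr (star f) = (Arr f)^*.
Proof. by []. Qed.
Lemma Arr_id X : Arr (idm X) = aid X. Proof. by []. Qed.
Lemma Arr_scale a X Y (f : Hom X Y) : Arr (a *: f) = ascale a (Arr f).
Proof. by []. Qed.

Definition ArrE := (@Arr_recast R C, Arr_comp, Arr_thom, Arr_star, Arr_id, Arr_scale).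

Lemma acompA h g f : h • (g • f) = h • g • f.
Proof.
have [e|ne] := pselect (cod f = dom g); last first.
  rewrite [g • f]acomp_mismatch // [RHS]acomp_mismatch //.
  have [e'|ne'] := pselect (cod g = dom h); last by rewrite acomp_mismatch.
  by case: h e' => X Y h /= e'; subst X; rewrite /acomp /= typed_Arr compm0.
have [e'|ne'] := pselect (cod g = dom h); last first.
  rewrite [LHS]acomp_mismatch // [h • g]acomp_mismatch //.
  by rewrite /acomp /= comp0m.
case: f g h e e' => [X Y f] [Y' Z g] [Z' W h] /= e e'; subst Y' Z'.
by rewrite -!Arr_comp compA.
Qed.

Lemma acomp1m Y f : Y = cod f -> aid Y • f = f.
Proof. by case: f => X Y' f /= ->; rewrite -Arr_id -Arr_comp comp1m. Qed.
Lemma acompm1 X f : X = dom f -> f • aid X = f.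
Proof. by case: f => X' Y' f /= ->; rewrite -Arr_id -Arr_comp compm1. Qed.

Lemma atenA f g h : (f ⊙ g) ⊙ h = f ⊙ (g ⊙ h).
Proof.
case: f g h => [X Y f] [X' Y' g] [X'' Y'' h].
by rewrite -!Arr_thom -thomA Arr_recast.
Qed.
Lemma aten1l f : aid 𝟙 ⊙ f = f.
Proof. by case: f => X Y f; rewrite -Arr_id -Arr_thom -[in RHS](thom1l f) Arr_recast. Qed.
Lemma aten1r f : f ⊙ aid 𝟙 = f.
Proof. by case: f => X Y f; rewrite -Arr_id -Arr_thom -[in RHS](thom1r f) Arr_recast. Qed.
Lemma aid_tob X Y : aid (X ⊗ Y) = aid X ⊙ aid Y.
Proof. by rewrite -!Arr_id -thom1. Qed.

Lemma aten_comp g f g' f' : cod f = dom g -> cod f' = dom g' ->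
  (g ⊙ g') • (f ⊙ f') = (g • f) ⊙ (g' • f').
Proof.
case: f g f' g' => [X Y f] [Z W g] [X' Y' f'] [Z' W' g'] /= e e'; subst.
by rewrite -!Arr_comp /aten /= thom_comp.
Qed.

Lemma astar_comp g f : (g • f)^* = f^* • g^*.
Proof.
have [e|ne] := pselect (cod f = dom g); last first.
  rewrite !acomp_mismatch //=; first by rewrite /astar /= star0.
  by move/esym.
case: f g e => [X Y f] [Z W g] /= e; subst Z.
by rewrite -Arr_comp -!Arr_star -Arr_comp star_comp.
Qed.
Lemma astar_ten f g : (f ⊙ g)^* = f^* ⊙ g^*.
Proof. by rewrite /astar /= thom_star. Qed.
Lemma astar_id X : (aid X)^* = aid X.
Proof. by rewrite /astar star1. Qed.
Lemma astarK f : f^*^* = f.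
Proof. by case: f => X Y f; rewrite /astar /= starK. Qed.
Definition astarE := (astar_comp, astar_ten, astar_id, astarK).

Lemma ascalel a g f : ascale a g • f = ascale a (g • f).
Proof. by rewrite /acomp /ascale /= compZl. Qed.
Lemma ascaler a g f : g • ascale a f = ascale a (g • f).
Proof.
have [e|ne] := pselect (cod f = dom g); last first.
  by rewrite !acomp_mismatch // /ascale /= scaler0.
case: f g e => [X Y f] [Z W g] /= e; subst Z.
by rewrite -Arr_comp /ascale /= -Arr_comp compZr.
Qed.
Lemma aten_scalel a g f : ascale a g ⊙ f = ascale a (g ⊙ f).
Proof. by rewrite /aten /ascale /= thomZl. Qed.
Lemma aten_scaler a g f : g ⊙ ascale a f = ascale a (g ⊙ f).
Proof. by rewrite /aten /ascale /= thomZr. Qed.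

(* Arrows carry no addition, so linearity of an arrow-valued expression is
   stated through a linear map into one morphism space. *)
Definition alinear X Y (E : Hom X Y -> arrow (C := C)) : Prop :=
  exists X' Y' (L : Hom X Y -> Hom X' Y'), linear L /\ forall x, E x = Arr (L x).

Lemma alinear_Arr X Y : alinear (fun x : Hom X Y => Arr x).
Proof. by exists X, Y, id. Qed.

Lemma alinear_compl X Y (E : Hom X Y -> arrow) g :
  alinear E -> alinear (fun x => g • E x).
Proof.
case=> X' [Y' [L [Llin EL]]]; have [e|ne] := pselect (Y' = dom g); last first.
  exists X', (cod g), (fun=> 0); split=> [a u v|x]; first by rewrite scaler0 addr0.
  by rewrite EL acomp_mismatch.
case: g e => Z W g /= e; subst Z; exists X', W, (fun x => comp g (L x)).
by split=> [a u v|x]; [rewrite Llin compDr compZr|rewrite EL Arr_comp].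
Qed.

Lemma alinear_compr X Y (E : Hom X Y -> arrow) g :
  alinear E -> alinear (fun x => E x • g).
Proof.
case=> X' [Y' [L [Llin EL]]]; have [e|ne] := pselect (cod g = X'); last first.
  exists (dom g), Y', (fun=> 0); split=> [a u v|x]; first by rewrite scaler0 addr0.
  by rewrite EL acomp_mismatch.
case: g e => Z W g /= e; subst W; exists Z, Y', (fun x => comp (L x) g).
by split=> [a u v|x]; [rewrite Llin compDl compZl|rewrite EL Arr_comp].
Qed.

Lemma alinear_tenl X Y (E : Hom X Y -> arrow) g :
  alinear E -> alinear (fun x => g ⊙ E x).
Proof.
case=> X' [Y' [L [Llin EL]]]; case: g => Z W g.
exists (Z ⊗ X'), (W ⊗ Y'), (fun x => g ⊠ L x).
by split=> [a u v|x]; [rewrite Llin thom_linearr|rewrite EL].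
Qed.

Lemma alinear_tenr X Y (E : Hom X Y -> arrow) g :
  alinear E -> alinear (fun x => E x ⊙ g).
Proof.
case=> X' [Y' [L [Llin EL]]]; case: g => Z W g.
exists (X' ⊗ Z), (Y' ⊗ W), (fun x => L x ⊠ g).
by split=> [a u v|x]; [rewrite Llin thom_linearl|rewrite EL].
Qed.

Lemma linear_typed X Y X' Y' (E : Hom X Y -> arrow) :
  alinear E -> linear (fun x => typed X' Y' (E x)).
Proof.
case=> Z [W [L [Llin EL]]] a u v; rewrite !EL Llin.
have [e|ne] := pselect (Z = X'); last by rewrite !typed0 ?scaler0 ?addr0 //=; left.
have [e'|ne] := pselect (W = Y'); last by rewrite !typed0 ?scaler0 ?addr0 //=; right.
by subst; rewrite !typed_Arr.
Qed.

End ArrowTheory.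

Ltac alin := repeat first [exact: alinear_Arr | apply: alinear_compl
  | apply: alinear_compr | apply: alinear_tenl | apply: alinear_tenr].
Ltac obj_eq := by rewrite /= ?tobA ?tob1l ?tob1r ?tobA.

(** * Frobenius reciprocity and multipliers *)

(* Frobenius reciprocity, for [Y] dual to [X]: [flat] is a bijection
   Mor(c, X ⊗ b) -> Mor(Y ⊗ c, b) with inverse [sharp], and [bend] is a
   bijection Mor(c ⊗ X, b) -> Mor(c, b ⊗ Y) with inverse [unbend].  They are
   locked so that [acompA] does not see through them. *)
HB.lock Definition flat (R : realType) (C : tensorCat R) (X Y : C)
    (r : Hom 𝟙 (Y ⊗ X)) (b : C) (t : arrow (C := C)) : arrow :=
  ((Arr r)^* ⊙ aid b) • (aid Y ⊙ t).
HB.lock Definition sharp (R : realType) (C : tensorCat R) (X Y : C)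
    (rb : Hom 𝟙 (X ⊗ Y)) (c : C) (t : arrow (C := C)) : arrow :=
  (aid X ⊙ t) • (Arr rb ⊙ aid c).
HB.lock Definition bend (R : realType) (C : tensorCat R) (X Y : C)
    (rb : Hom 𝟙 (X ⊗ Y)) (c : C) (t : arrow (C := C)) : arrow :=
  (t ⊙ aid Y) • (aid c ⊙ Arr rb).
HB.lock Definition unbend (R : realType) (C : tensorCat R) (X Y : C)
    (r : Hom 𝟙 (Y ⊗ X)) (b : C) (t : arrow (C := C)) : arrow :=
  (aid b ⊙ (Arr r)^*) • (t ⊙ aid X).

Ltac obj := by rewrite ?flat.unlock ?sharp.unlock ?bend.unlock ?unbend.unlock /=
  ?tobA ?tob1l ?tob1r ?tobA.

Section Diagrams.
Context {R : realType} {C : tensorCat R}.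
Implicit Types (X Y Z a b c : C) (f g h t : arrow (C := C)).

Lemma aten_l f g : f ⊙ g = (f ⊙ aid (cod g)) • (aid (dom f) ⊙ g).
Proof. by rewrite aten_comp // acompm1 // acomp1m. Qed.
Lemma aten_r f g : f ⊙ g = (aid (cod f) ⊙ g) • (f ⊙ aid (dom g)).
Proof. by rewrite aten_comp // acompm1 // acomp1m. Qed.
Lemma slide f g : (f ⊙ aid (cod g)) • (aid (dom f) ⊙ g) =
  (aid (cod f) ⊙ g) • (f ⊙ aid (dom g)).
Proof. by rewrite -aten_l -aten_r. Qed.
Lemma whiskl X g f : cod f = dom g ->
  aid X ⊙ (g • f) = (aid X ⊙ g) • (aid X ⊙ f).
Proof. by move=> e; rewrite aten_comp // acomp1m. Qed.
Lemma whiskr X g f : cod f = dom g ->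
  (g • f) ⊙ aid X = (g ⊙ aid X) • (f ⊙ aid X).
Proof. by move=> e; rewrite aten_comp // acomp1m. Qed.

Section Dual.
Context {X Y : C} {r : Hom 𝟙 (Y ⊗ X)} {rb : Hom 𝟙 (X ⊗ Y)}.
Hypothesis D : conjugate_eqs r rb.

Lemma zigX : ((Arr rb)^* ⊙ aid X) • (aid X ⊙ Arr r) = aid X.
Proof. by have /(congr1 (@Arr _ _ _ _)) := D.1; rewrite !ArrE. Qed.
Lemma zigY : ((Arr r)^* ⊙ aid Y) • (aid Y ⊙ Arr rb) = aid Y.
Proof. by have /(congr1 (@Arr _ _ _ _)) := D.2; rewrite !ArrE. Qed.
Lemma zagX : (aid X ⊙ (Arr r)^*) • (Arr rb ⊙ aid X) = aid X.
Proof. by have /(congr1 astar) := zigX; rewrite !astarE. Qed.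

Lemma conjugate_sym : conjugate_eqs rb r.
Proof. by case: D. Qed.

(** The interchange law moves [t] past the new cup, and what remains of the bend is a zigzag
    identity. The next three lemmas follow the same pattern. *)
Lemma flatK b c t : dom t = c -> cod t = X ⊗ b -> sharp rb c (flat r b t) = t.
Proof.
case: t => c' b' t /= dt ct; subst; rewrite sharp.unlock flat.unlock whiskl; last by obj.
rewrite -acompA -[aid X ⊙ (aid Y ⊙ _)]atenA -aid_tob aten_comp // acomp1m // acompm1 //.
rewrite [Arr rb ⊙ _]aten_l /= aten1l acompA aid_tob -!atenA -whiskr //; last by obj.
by rewrite zagX -aid_tob acomp1m.
Qed.

Lemma sharpK b c t : dom t = Y ⊗ c -> cod t = b -> flat r b (sharp rb c t) = t.
Proof.
case: t => c' b' t /= dt ct; subst; rewrite sharp.unlock flat.unlock whiskl; last by obj.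
rewrite acompA -[aid Y ⊙ (aid X ⊙ _)]atenA -aid_tob aten_comp // acomp1m //= acompm1 //.
rewrite [(Arr r)^* ⊙ _]aten_r /= aten1l -acompA aid_tob -!atenA -whiskr //; last by obj.
by rewrite zigY -aid_tob acompm1.
Qed.

Lemma bendK b c t : dom t = c ⊗ X -> cod t = b -> unbend r b (bend rb c t) = t.
Proof.
case: t => c' b' t /= dt ct; subst; rewrite unbend.unlock bend.unlock whiskr; last by obj.
rewrite acompA !atenA -aid_tob aten_comp // acomp1m //= acompm1 //.
rewrite [Arr t ⊙ _]aten_l /= aten1r -acompA aid_tob !atenA -whiskl //; last by obj.
by rewrite zagX -aid_tob acompm1.
Qed.

Lemma unbendK b c t : dom t = c -> cod t = b ⊗ Y -> bend rb c (unbend r b t) = t.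
Proof.
case: t => c' b' t /= dt ct; subst; rewrite unbend.unlock bend.unlock whiskr; last by obj.
rewrite -acompA !atenA -aid_tob aten_comp // acompm1 //= acomp1m //.
rewrite [Arr t ⊙ _]aten_r /= aten1r acompA aid_tob !atenA -whiskl //; last by obj.
by rewrite zigY -aid_tob acomp1m.
Qed.

Lemma flat_inj b c t t' : dom t = c -> cod t = X ⊗ b -> dom t' = c -> cod t' = X ⊗ b ->
  flat r b t = flat r b t' -> t = t'.
Proof. by move=> dt ct dt' ct' e; rewrite -(flatK dt ct) -(flatK dt' ct') e. Qed.

Lemma bend_inj b c t t' : dom t = c ⊗ X -> cod t = b -> dom t' = c ⊗ X -> cod t' = b ->
  bend rb c t = bend rb c t' -> t = t'.
Proof. by move=> dt ct dt' ct' e; rewrite -(bendK dt ct) -(bendK dt' ct') e. Qed.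

End Dual.
End Diagrams.

Section FlatTheory.
Context {R : realType} {C : tensorCat R}.
Implicit Types (X Y Z a b c : C) (f g h t : arrow (C := C)).

Lemma flat_comp X Y (r : Hom 𝟙 (Y ⊗ X)) b c c' (t : Hom c (X ⊗ b)) (f : Hom c' c) :
  flat r b (Arr t • Arr f) = flat r b (Arr t) • (aid Y ⊙ Arr f).
Proof. by rewrite flat.unlock -acompA -whiskl. Qed.

Lemma flat_post X Y (r : Hom 𝟙 (Y ⊗ X)) b b' c (t : Hom c (X ⊗ b)) (g : Hom b b') :
  flat r b' ((aid X ⊙ Arr g) • Arr t) = Arr g • flat r b (Arr t).
Proof.
rewrite flat.unlock whiskl // acompA -atenA -aid_tob -[aid b']/(aid (cod (Arr g))).
by rewrite [X in X • _](slide (Arr r)^* (Arr g)) /= aten1l -acompA.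
Qed.

Lemma flat_tenr X Y (r : Hom 𝟙 (Y ⊗ X)) b c e (t : Hom c (X ⊗ b)) :
  flat r (b ⊗ e) (Arr t ⊙ aid e) = flat r b (Arr t) ⊙ aid e.
Proof. by rewrite flat.unlock whiskr; [rewrite !aid_tob !atenA | obj]. Qed.

(** When an evaluation [q] is expressed through that of [X], replacing one by the other amounts to
    precomposition with [k]. *)
Lemma flat_factor X Y (r : Hom 𝟙 (Y ⊗ X)) W (q : Hom (W ⊗ X) 𝟙) (k : Hom W Y) b c
    (t : Hom c (X ⊗ b)) :
  Arr q = (Arr r)^* • (Arr k ⊙ aid X) ->
  (Arr q ⊙ aid b) • (aid W ⊙ Arr t) = flat r b (Arr t) • (Arr k ⊙ aid c).
Proof.
move=> ->; rewrite whiskr // flat.unlock -!acompA atenA -aid_tob; congr (_ • _).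
by rewrite [LHS](slide (Arr k) (Arr t)).
Qed.

Lemma bend_comp X Y (rb : Hom 𝟙 (X ⊗ Y)) t f : dom t = cod f ⊗ X ->
  bend rb (dom f) (t • (f ⊙ aid X)) = bend rb (cod f) t • f.
Proof.
move=> dt; rewrite bend.unlock whiskr // -!acompA atenA -aid_tob; congr (_ • _).
by rewrite [LHS](slide f (Arr rb)) /= aten1r.
Qed.

(** Frobenius reciprocity for pairings: [k] is [q] with its strand [X] bent. This is the tool that
    relates conjugates chosen independently of each other. *)
Lemma eval_factor X Y (r : Hom 𝟙 (Y ⊗ X)) (rb : Hom 𝟙 (X ⊗ Y)) (D : conjugate_eqs r rb)
    W (q : Hom (W ⊗ X) 𝟙) :
  exists k : Hom W Y, Arr q = (Arr r)^* • (Arr k ⊙ aid X).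
Proof.
exists (typed W Y (bend rb W (Arr q))); rewrite Arr_typed //=; try obj.
by rewrite -[LHS](bendK D (b := 𝟙) (c := W)) // unbend.unlock aten1l.
Qed.

Section Twist.
Variable G : forall Y : C, Hom Y Y.
Hypothesis Gnat : forall Y Z (f : Hom Y Z), comp (G Z) f = comp f (G Y).

Lemma arrow_nat t : Arr (G (cod t)) • t = t • Arr (G (dom t)).
Proof. by case: t => X Y f /=; rewrite -!Arr_comp Gnat. Qed.

(* This is Theta^psi for [G Y] the sum of the [psi k *: P^k_Y]: only a dual of
   the left tensor factor of the target enters. *)
Definition twist X Y (r : Hom 𝟙 (Y ⊗ X)) (rb : Hom 𝟙 (X ⊗ Y)) a b b'
    (x : Hom (a ⊗ b') (X ⊗ b)) : Hom (a ⊗ b') (X ⊗ b) :=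
  typed _ _ (sharp rb (a ⊗ b') (flat r b (Arr x) • (Arr (G (Y ⊗ a)) ⊙ aid b'))).

Lemma twist_linear X Y (r : Hom 𝟙 (Y ⊗ X)) (rb : Hom 𝟙 (X ⊗ Y)) a b b' :
  linear (@twist X Y r rb a b b').
Proof. by apply: linear_typed; rewrite sharp.unlock flat.unlock; alin. Qed.

Lemma Arr_twist X Y (r : Hom 𝟙 (Y ⊗ X)) (rb : Hom 𝟙 (X ⊗ Y)) a b b' (x : Hom (a ⊗ b') (X ⊗ b)) :
  Arr (twist r rb x) =
  sharp rb (a ⊗ b') (flat r b (Arr x) • (Arr (G (Y ⊗ a)) ⊙ aid b')).
Proof. by rewrite Arr_typed; try obj. Qed.

Lemma flat_twist X Y (r : Hom 𝟙 (Y ⊗ X)) (rb : Hom 𝟙 (X ⊗ Y))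
    (D : conjugate_eqs r rb) a b b' (x : Hom (a ⊗ b') (X ⊗ b)) :
  flat r b (Arr (twist r rb x)) = flat r b (Arr x) • (Arr (G (Y ⊗ a)) ⊙ aid b').
Proof. by rewrite Arr_twist (sharpK D) //=; obj. Qed.

Lemma twist_unique X Y (r : Hom 𝟙 (Y ⊗ X)) (rb : Hom 𝟙 (X ⊗ Y))
    (D : conjugate_eqs r rb) a b b' (x y : Hom (a ⊗ b') (X ⊗ b)) :
  flat r b (Arr y) = flat r b (Arr x) • (Arr (G (Y ⊗ a)) ⊙ aid b') ->
  twist r rb x = y.
Proof.
move=> e; apply: Arr_inj; apply: (flat_inj D (b := b)) => //.
by rewrite (flat_twist D).
Qed.

Lemma twist_tenr X Y (r : Hom 𝟙 (Y ⊗ X)) (rb : Hom 𝟙 (X ⊗ Y))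
    (D : conjugate_eqs r rb) e a b b' (x : Hom (a ⊗ b') (X ⊗ b))
    (y : Hom (a ⊗ (b' ⊗ e)) (X ⊗ (b ⊗ e))) :
  Arr y = Arr x ⊙ aid e -> Arr (twist r rb y) = Arr (twist r rb x) ⊙ aid e.
Proof.
move=> ey; pose z := typed (a ⊗ (b' ⊗ e)) (X ⊗ (b ⊗ e)) (Arr (twist r rb x) ⊙ aid e).
have ez : Arr z = Arr (twist r rb x) ⊙ aid e by rewrite Arr_typed; try obj.
rewrite -ez; congr Arr; apply: (twist_unique D).
rewrite ez ey !flat_tenr (flat_twist D) whiskr; last obj.
by rewrite aid_tob atenA.
Qed.

Section OneTwist.
Context {X Y : C} {r : Hom 𝟙 (Y ⊗ X)} {rb : Hom 𝟙 (X ⊗ Y)}.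
Hypothesis D : conjugate_eqs r rb.

(* The evaluation of the dual of [α ⊗ X] factors through that of [X], so the
   two duals need not be related. *)
Lemma twist_tensor A Y' (r' : Hom 𝟙 (Y' ⊗ A)) (rb' : Hom 𝟙 (A ⊗ Y')) α e
    (D' : conjugate_eqs r' rb') (eA : α ⊗ X = A)
    a b b' (x : Hom (a ⊗ b') (X ⊗ b))
    (y : Hom ((α ⊗ a) ⊗ (b' ⊗ e)) (A ⊗ (b ⊗ e))) :
  Arr y = aid α ⊙ Arr x ⊙ aid e ->
  Arr (twist r' rb' y) = aid α ⊙ Arr (twist r rb x) ⊙ aid e.
Proof.
case: A / eA r' rb' D' y => r' rb' D' y ey.
have eq1 : (Y' ⊗ (α ⊗ X)) = (Y' ⊗ α) ⊗ X by rewrite tobA.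
pose q := recast (star r') eq1 erefl.
have [k ek] := eval_factor D q.
have eq' : Arr q = (Arr r')^* by rewrite Arr_recast.
have flat' (t : Hom (a ⊗ b') (X ⊗ b)) : flat r' (b ⊗ e) (aid α ⊙ Arr t ⊙ aid e) =
    (flat r b (Arr t) • (Arr k ⊙ aid (a ⊗ b'))) ⊙ aid e.
  rewrite -(flat_factor t ek) eq' whiskr //=; last obj.
  by rewrite flat.unlock !aid_tob !atenA.
pose z := typed _ _ (aid α ⊙ Arr (twist r rb x) ⊙ aid e)
  : Hom ((α ⊗ a) ⊗ (b' ⊗ e)) ((α ⊗ X) ⊗ (b ⊗ e)).
have ez : Arr z = aid α ⊙ Arr (twist r rb x) ⊙ aid e by rewrite Arr_typed; try obj.
rewrite -ez; congr Arr.
apply: Arr_inj; apply: (flat_inj D' (b := b ⊗ e)) => //.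
rewrite (flat_twist D') ez ey !flat' (flat_twist D) [aid (b' ⊗ e)]aid_tob.
rewrite -[_ ⊙ (aid b' ⊙ aid e)]atenA -whiskr; last obj.
congr (_ ⊙ _); rewrite -!acompA; congr (_ • _).
rewrite aid_tob -!atenA -!whiskr //; try obj.
congr (_ ⊙ _).
by have := arrow_nat (Arr k ⊙ aid a); rewrite /= -tobA => ->.
Qed.

(** The evaluation of [X'] after [f1] factors through that of [X] by some [k : Y' -> Y], and [G]
    passes [k ⊠ f2] by naturality. Bimodularity is the special case of equal objects; the general
    form also moves between a summand and the whole object. *)
Lemma twist_natural X' Y' (r' : Hom 𝟙 (Y' ⊗ X')) (rb' : Hom 𝟙 (X' ⊗ Y'))
    (D' : conjugate_eqs r' rb') a b b' a2 b1 b2 (f1 : Hom X X') (g1 : Hom b b1)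
    (x : Hom (a ⊗ b') (X ⊗ b)) (f2 : Hom a2 a) (g2 : Hom b2 b') :
  twist r' rb' (comp (comp (f1 ⊠ g1) x) (f2 ⊠ g2)) =
  comp (comp (f1 ⊠ g1) (twist r rb x)) (f2 ⊠ g2).
Proof.
pose q := typed (Y' ⊗ X) 𝟙 ((Arr r')^* • (aid Y' ⊙ Arr f1)) : Hom (Y' ⊗ X) 𝟙.
have [k ek] := eval_factor D q.
have eq' : Arr q = (Arr r')^* • (aid Y' ⊙ Arr f1) by rewrite Arr_typed.
have flat' (t : Hom (a ⊗ b') (X ⊗ b)) :
    flat r' b1 (Arr (comp (comp (f1 ⊠ g1) t) (f2 ⊠ g2))) =
    Arr g1 • flat r b (Arr t) • (Arr k ⊙ Arr f2 ⊙ Arr g2).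
  rewrite Arr_comp flat_comp !Arr_comp !Arr_thom.
  rewrite [Arr f1 ⊙ _]aten_r /= -acompA.
  rewrite -[Arr f1 ⊙ aid b]Arr_thom -[(Arr (f1 ⊠ _)) • _]Arr_comp flat_post.
  rewrite Arr_comp Arr_thom Arr_id -!acompA; congr (_ • _).
  have -> : flat r' b (Arr f1 ⊙ aid b • Arr t) = (Arr q ⊙ aid b) • (aid Y' ⊙ Arr t).
    by rewrite eq' whiskr // flat.unlock whiskl // acompA atenA.
  rewrite (flat_factor t ek) -(acompA (flat _ _ _)); congr (_ • _).
  by rewrite aten_comp // acomp1m // acompm1.
apply: (@Arr_inj R C); apply: (flat_inj D' (b := b1)) => //.
rewrite (flat_twist D') !flat' (flat_twist D) -!acompA; congr (_ • (_ • _)).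
rewrite -!atenA !aten_comp //; try obj.
by rewrite acomp1m // acompm1 //; have := arrow_nat (Arr k ⊙ Arr f2) => /= ->.
Qed.

End OneTwist.
End Twist.
End FlatTheory.

(** * Semisimplicity *)

Section Projections.
Context {R : realType} {C : cstarCat R}.
Implicit Types X Y Z : C.

Definition postcomp X Y Z (g : Hom Y Z) (f : Hom X Y) : Hom X Z := comp g f.
HB.instance Definition _ X Y Z (g : Hom Y Z) :=
  GRing.isLinear.Build R[i] (Hom X Y) (Hom X Z) _ (@postcomp X Y Z g)
    (comp_linearr g).

Definition postcomp_mx X (a : Hom X X) : 'M[R[i]]_(dim (Hom X X)) :=
  lin1_mx (v2r \o postcomp a \o r2v).

Lemma mul_postcomp_mx X (a : Hom X X) v :
  v *m postcomp_mx a = v2r (comp a (r2v v)).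
Proof. by rewrite mul_rV_lin1. Qed.

Lemma postcomp_eigen X (a : Hom X X) : idm X <> 0 ->
  exists (c : R[i]) (x : Hom X X), x != 0 /\ comp a x = c *: x.
Proof.
move=> X0; have [|c] := @eigenvalue_closed _ _ (postcomp_mx a).
  rewrite lt0n; apply/negP => /eqP d0; apply: X0.
  have : v2r (idm X) = 0 by apply/rowP => i; have := ltn_ord i; rewrite [X in (_ < X)%N]d0.
  by move=> e; apply: (can_inj v2rK); rewrite e linear0.
case/eigenvalueP=> v; rewrite mul_postcomp_mx => e v0; exists c, (r2v v); split.
  by apply: contraNneq v0 => e0; rewrite -[v]r2vK e0 linear0.
by rewrite -[LHS]v2rK e linearZ.
Qed.

(** The support projection of [b]. By self-adjointness [b b x = 0] forces [b x = 0], so left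
    multiplications by [b] and by [b b] have equal rank and [b = b b c] for some [c]. Then [e = b c]
    satisfies [star e e = e], which makes it a projection. *)
Lemma selfadjoint_projection X (b : Hom X X) : star b = b ->
  exists e, [/\ projection e, comp e b = b & exists c, e = comp c b].
Proof.
move=> sb; pose M := postcomp_mx b.
have MM : (M <= M *m M)%MS.
  suff /eqP e : \rank (M *m M) == \rank M by rewrite -(geq_leqif (mxrank_leqif_sup (submxMl M M))) e.
  rewrite -(mxrank_mul_ker M M) -[X in X == _]addn0 eqn_add2l eq_sym mxrank_eq0.
  apply/eqP/row_matrixP => i; rewrite row0; have := row_sub i (M :&: kermx M)%MS.
  rewrite sub_capmx => /andP[/submxP[v ->] /sub_kermxP].
  rewrite !mul_postcomp_mx v2rK => e; rewrite (_ : comp b _ = 0) ?linear0 //.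
  apply: starcomp_eq0; rewrite star_comp sb -compA.
  by rewrite (_ : comp b _ = 0) ?compm0 //; apply: (can_inj v2rK); rewrite e linear0.
have [D MD] := submxP MM; pose c := r2v (v2r (idm X) *m D).
have bc : b = comp b (comp b c).
  apply: (can_inj v2rK); rewrite -[in LHS](compm1 b) -[in LHS](v2rK (idm X)).
  by rewrite -mul_postcomp_mx -/M MD !mulmxA !mul_postcomp_mx v2rK.
have cb : comp (star c) (comp b b) = b.
  by rewrite -[RHS]sb [in RHS]bc !star_comp sb compA.
pose e := comp b c.
have ee : comp (star e) e = e.
  by rewrite /e star_comp sb compA -[comp (comp _ b) b]compA cb.
have se : star e = e by rewrite -[in LHS]ee star_comp starK.
exists e; split.
- by split=> //; rewrite -[X in comp X]se.
- by rewrite -[X in comp X]se /e star_comp sb -compA cb.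
- by exists (star c); rewrite -se /e star_comp sb.
Qed.

(** The real or the imaginary part [a] of [f] is not scalar. For an eigenvalue [c] of [a],
    necessarily real, [a - c] is nonzero and kills an eigenvector, so its support projection is
    neither 0 nor the identity. *)
Lemma nontrivial_projection X (f : Hom X X) : idm X <> 0 ->
  (forall c, f <> c *: idm X) ->
  exists p, [/\ projection p, p <> 0 & p <> idm X].
Proof.
move=> X0 fns.
have [a [sa ans]] : exists a, star a = a /\ forall c, a <> c *: idm X.
  apply: contrapT => none.
  have H a : star a = a -> exists c, a = c *: idm X.
    move=> sa; apply: contrapT => h; apply: none; exists a; split=> // c e.
    by apply: h; exists c.
  have [|c1 e1] := H (f + star f); first by rewrite starD starK addrC.
  pose I : R[i] := 'i%C.
  have II : I * I = -1 by rewrite -expr2 sqr_i.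
  have cI : conjc I = - I by apply/eqP; rewrite eq_complex /= oppr0 !eqxx.
  have [|c2 e2] := H (I *: (f - star f)).
    by rewrite starZ starB starK cI scaleNr -scalerN opprB.
  apply: (fns (2^-1 * (c1 - I * c2))).
  rewrite -scalerA scalerBl -(scalerA I) -e1 -e2 scalerA II scaleN1r opprK.
  have -> : f + star f + (f - star f) = (2 : R[i]) *: f.
    by rewrite addrACA subrr addr0 scaler_nat mulr2n.
  by rewrite scalerA mulVf ?scale1r // pnatr_eq0.
have [c [x [x0 ax]]] := postcomp_eigen a X0.
have cr : conjc c = c.
  have : comp (star x) (comp a x) = conjc c *: comp (star x) x.
    by rewrite compA -[X in comp (comp _ X)]sa -star_comp ax starZ compZl.
  rewrite ax compZr => /eqP; rewrite -subr_eq0 -scalerBl scaler_eq0 subr_eq0.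
  by case/orP=> [/eqP/esym //|/eqP/starcomp_eq0 e]; rewrite e eqxx in x0.
pose b := a - c *: idm X.
have sb : star b = b by rewrite starB starZ star1 cr sa.
have bx : comp b x = 0 by rewrite compBl ax compZl comp1m subrr.
have [e [pe eb [d ed]]] := selfadjoint_projection sb.
exists e; split=> // e1.
  by move: eb; rewrite e1 comp0m => /esym/subr0_eq; apply: ans.
move: x0; rewrite -[x]comp1m -e1 ed -compA bx compm0 eqxx //.
Qed.

End Projections.

Section SimpleObjects.
Context {R : realType} {C : cstarCat R}.
Implicit Types X Y Z : C.

Definition scalar_of X (f : Hom X X) : R[i] := coord [tuple idm X] ord0 f.

Lemma simple_id X : simple X -> idm X <> 0.
Proof.
move=> sX e; move: sX; rewrite /simple (_ : fullv = 0%VS) ?dimv0 //.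
by apply/eqP; rewrite -subv0; apply/subvP => f _; rewrite -[f]comp1m e comp0m memv0.
Qed.

Lemma scalar_ofZ X a : simple X -> scalar_of (a *: idm X) = a.
Proof.
move=> sX; rewrite /scalar_of linearZ /=.
rewrite (_ : idm X = [tuple idm X]`_(ord0 : 'I_1)) // coord_free ?eqxx ?mulr1 //.
by rewrite seq1_free; apply/eqP/simple_id.
Qed.

Lemma scalar_ofE X (f : Hom X X) : simple X -> f = scalar_of f *: idm X.
Proof.
move=> sX; have b : basis_of fullv [tuple idm X].
  by rewrite basisEfree seq1_free subvf sX andbT; apply/eqP/simple_id.
by rewrite {1}(coord_basis b (memvf f)) big_ord1.
Qed.

Lemma scalar_of_star X (f : Hom X X) : simple X -> scalar_of (star f) = conjc (scalar_of f).
Proof. by move=> sX; rewrite {1}(scalar_ofE f sX) starZ star1 scalar_ofZ. Qed.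

Lemma scalar_of_ge0 X Y (f : Hom X Y) : simple X -> 0 <= scalar_of (comp (star f) f).
Proof.
move=> sX; have [g ->] := star_pos f.
rewrite [X in comp _ X](scalar_ofE g sX) [X in star X](scalar_ofE g sX).
rewrite starZ star1 compZl compZr comp1m scalerA scalar_ofZ // mulrC.
exact: mul_conjC_ge0.
Qed.

Lemma scalar_of_eq0 X Y (f : Hom X Y) : simple X -> scalar_of (comp (star f) f) = 0 -> f = 0.
Proof.
by move=> sX e; apply: starcomp_eq0; rewrite (scalar_ofE (comp _ f) sX) e scale0r.
Qed.

(** Both [star f f] and [f star f] are scalars. They agree by evaluating [f star f f] in two ways
    and are nonzero by the C*-identity, so a multiple of [star f] inverts [f]. *)
Lemma schur X Y (f : Hom X Y) : simple X -> simple Y -> f <> 0 -> isom X Y.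
Proof.
move=> sX sY f0; pose c := scalar_of (comp (star f) f).
pose c' := scalar_of (comp f (star f)).
have c0 : c != 0 by apply/eqP => /(scalar_of_eq0 sX).
have ec : comp (star f) f = c *: idm X := scalar_ofE _ sX.
have ec' : comp f (star f) = c' *: idm Y := scalar_ofE _ sY.
have cc : c = c'.
  have : comp f (comp (star f) f) = c' *: f by rewrite compA ec' compZl comp1m.
  rewrite ec compZr compm1 => /eqP; rewrite -subr_eq0 -scalerBl scaler_eq0 subr_eq0.
  by case/orP=> /eqP.
exists f, (c^-1 *: star f); rewrite compZl compZr ec ec' -cc !scalerA mulVf //.
by rewrite !scale1r.
Qed.

Lemma nonscalar X : idm X <> 0 -> ~ simple X -> exists f : Hom X X, forall c, f <> c *: idm X.
Proof.
move=> X0 nsX; apply: contrapT => none; apply: nsX; rewrite /simple.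
rewrite (_ : fullv = <[idm X]>%VS) ?dim_vline; first by move/eqP: X0 => ->.
apply: subv_anti; rewrite subvf andbT; apply/subvP => f _; apply/vlineP.
by apply: contrapT => h; apply: none; exists f => c e; apply: h; exists c.
Qed.

Lemma dim_lt_injective (U V : vectType R[i]) (L : U -> V) (w : V) :
  linear L -> injective L -> (forall u, L u <> w) -> (dim U < dim V)%N.
Proof.
move=> Llin Linj Lw; pose LM := GRing.isLinear.Build _ _ _ _ L Llin.
pose L' : {linear U -> V} := HB.pack L LM.
pose M := lin1_mx (v2r \o L' \o r2v).
have ME v : v *m M = v2r (L (r2v v)) by rewrite mul_rV_lin1.
have Mfree : row_free M.
  rewrite -kermx_eq0; apply/eqP/row_matrixP => i; rewrite row0.
  have /sub_kermxP := row_sub i (kermx M); rewrite ME => e.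
  apply: (can_inj r2vK); apply: Linj; apply: (can_inj v2rK); rewrite e.
  by rewrite linear0 (lin_zero Llin) linear0.
have le := rank_leq_col M; rewrite ltn_neqAle -{2}(eqP Mfree) le andbT.
apply/eqP => e; have Mfull : row_full M by rewrite /row_full (eqP Mfree) e.
have /submxP[D wD] := submx_full (v2r w) Mfull.
by apply: (Lw (r2v D)); apply: (can_inj v2rK); rewrite -ME wD.
Qed.

(** The map [h |-> v h star v] is injective and misses the identity. This strict drop is the measure
    for the induction in [simple_splitting]. *)
Lemma dim_sub_projection X Y (v : Hom X Y) :
  isometry v -> comp v (star v) <> idm Y -> (dim (Hom X X) < dim (Hom Y Y))%N.
Proof.
move=> vi pv; apply: (@dim_lt_injective _ _ (fun h => comp (comp v h) (star v)) (idm Y)).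
- by move=> a f g; rewrite compDr compZr compDl compZl.
- move=> f g /(congr1 (fun h => comp (comp (star v) h) v)).
  by rewrite -!compA vi !compm1 !compA vi !comp1m.
- move=> h e; apply: pv; rewrite -[X in comp X _]comp1m -e -!compA [comp _ (comp v _)]compA.
  by rewrite vi comp1m.
Qed.

End SimpleObjects.

Section Semisimple.
Context {R : realType} {C : rigidCstarTensorCat R} (S : choices C).
Local Notation I := (Irr S).
Local Notation X_ := (rep (c := S)).
Implicit Types (X Y Z : C) (k l : I).

Lemma schur_rep k l (f : Hom (X_ k) (X_ l)) : k <> l -> f = 0.
Proof.
move=> kl; apply: contrapT => f0; apply: kl; apply: rep_inj.
exact: (schur (rep_simple k) (rep_simple l) f0).
Qed.

(** A nontrivial projection and its complement cut out two subobjects with smaller endomorphism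
    algebras; the splittings of both are transported along the isometries. *)
Lemma simple_splitting Y : exists s : seq {k : I & (Hom (X_ k) Y * Hom Y (X_ k))%type},
  idm Y = \sum_(t <- s) comp (projT2 t).1 (projT2 t).2.
Proof.
have [n] := ubnP (dim (Hom Y Y)); elim: n Y => // n IH Y; rewrite ltnS => dn.
have [Y0|Y0] := pselect (idm Y = 0); first by exists [::]; rewrite big_nil.
have [sY|nsY] := pselect (simple Y).
  have [k [f [g [gf fg]]]] := rep_surj S sY.
  by exists [:: existT _ k (g, f)]; rewrite big_seq1.
have [f nf] := nonscalar Y0 nsY.
have [p [pp p0 p1]] := nontrivial_projection Y0 nf.
have pp' : projection (idm Y - p).
  case: pp => sp cp; split; first by rewrite starB star1 sp.
  by rewrite compBl comp1m compBr compm1 cp subrr subr0.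
have [Z [v [vi vp]]] := rigid_subobjects pp.
have [Z' [v' [vi' vp']]] := rigid_subobjects pp'.
have [s es] : exists s : seq {k : I & (Hom (X_ k) Z * Hom Z (X_ k))%type},
  idm Z = \sum_(t <- s) comp (projT2 t).1 (projT2 t).2.
  by apply: IH; apply: leq_trans dn; apply: dim_sub_projection vi _; rewrite vp.
have [s' es'] : exists s : seq {k : I & (Hom (X_ k) Z' * Hom Z' (X_ k))%type},
  idm Z' = \sum_(t <- s) comp (projT2 t).1 (projT2 t).2.
  apply: IH; apply: leq_trans dn; apply: dim_sub_projection vi' _; rewrite vp'.
  by move/(canRL (subrK _)) => e; apply: p0; apply: (addrI (idm Y)); rewrite addr0 -e.
pose F (W : C) (w : Hom W Y) (t : {k : I & (Hom (X_ k) W * Hom W (X_ k))%type}) :=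
  existT (fun k => (Hom (X_ k) Y * Hom Y (X_ k))%type) (projT1 t)
    (comp w (projT2 t).1, comp (projT2 t).2 (star w)).
have FE W (w : Hom W Y) r : idm W = \sum_(t <- r) comp (projT2 t).1 (projT2 t).2 ->
    \sum_(t <- map (F W w) r) comp (projT2 t).1 (projT2 t).2 = comp w (star w).
  move=> e; rewrite big_map /= -[X in comp X _]compm1 e comp_sumr comp_suml.
  by apply: eq_bigr => t _; rewrite !compA.
exists (map (F Z v) s ++ map (F Z' v') s'); rewrite big_cat /= !FE // vp vp'.
by rewrite addrC subrK.
Qed.

Lemma finite_support Y : exists L : seq I, forall k (f : Hom (X_ k) Y), k \notin L -> f = 0.
Proof.
have [s es] := simple_splitting Y; exists (map (fun t => projT1 t) s) => k f kL.
rewrite -[f]comp1m es comp_suml big1_seq // => t /andP[_ ts].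
rewrite -compA (_ : comp _ f = 0) ?compm0 //; apply: schur_rep => e.
by move: kL; rewrite e (map_f (fun t => projT1 t)).
Qed.

Lemma onb_ortho k Y (i j : nat) : (i < size (onb k Y))%N -> (j < size (onb k Y))%N ->
  comp (star (onb k Y)`_i) (onb k Y)`_j = (i == j)%:R *: idm (X_ k).
Proof. exact: (onbP k Y).2. Qed.

Lemma onb_expand k Y (f : Hom (X_ k) Y) :
  f = \sum_(V <- onb k Y) comp V (comp (star V) f).
Proof.
have [b o] := onbP k Y; pose n := size (onb k Y); pose t := in_tuple (onb k Y).
have ef := coord_basis (b : basis_of fullv t) (memvf f).
rewrite (big_nth 0) big_mkord {1}ef; apply: eq_bigr => i _.
have -> : comp (star (onb k Y)`_i) f = coord t i f *: idm (X_ k).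
  rewrite {1}ef comp_sumr (bigD1 i) //= compZr o // eqxx scale1r big1 ?addr0 // => j ji.
  have /negPf ij : (i : nat) != j by rewrite eq_sym; exact: ji.
  by rewrite compZr o // ij scale0r scaler0.
by rewrite compZr compm1.
Qed.

Lemma onb_isometry k Y V : V \in onb k Y -> isometry V.
Proof.
move=> Vk; rewrite /isometry -(nth_index 0 Vk) onb_ortho ?index_mem //.
by rewrite eqxx scale1r.
Qed.

Definition proj_iso k Y : Hom Y Y := \sum_(V <- onb k Y) comp V (star V).

Lemma proj_iso_id k Y (f : Hom (X_ k) Y) : comp (proj_iso k Y) f = f.
Proof.
rewrite [RHS]onb_expand comp_suml; apply: eq_bigr => V _; by rewrite compA.
Qed.

Lemma proj_iso_0 k l Y (f : Hom (X_ l) Y) : k <> l -> comp (proj_iso k Y) f = 0.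
Proof.
move=> kl; rewrite comp_suml big1 // => V _; rewrite -compA.
by rewrite (schur_rep (comp (star V) f)) ?compm0 //; move/esym.
Qed.

Lemma star_proj_iso k Y : star (proj_iso k Y) = proj_iso k Y.
Proof. by rewrite star_sum; apply: eq_bigr => V _; rewrite star_comp starK. Qed.

Lemma decomposition Y (L : seq I) : uniq L ->
  (forall k (f : Hom (X_ k) Y), k \notin L -> f = 0) ->
  idm Y = \sum_(k <- L) proj_iso k Y.
Proof.
move=> uL cov; have [s es] := simple_splitting Y.
rewrite -[RHS]compm1 {2}es comp_sumr {1}es; apply: eq_bigr => -[k [u v]] _ /=.
rewrite compA; congr comp; rewrite comp_suml.
have [kL|kL] := boolP (k \in L); last by rewrite [u]cov // big1 // => l _; rewrite compm0.
rewrite (bigD1_seq k) //= proj_iso_id big1 ?addr0 // => l lk.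
by rewrite proj_iso_0 //; apply/eqP.
Qed.

(** Once [f] is expanded over the decomposition of [Y], the part coming from [X_l] is fixed by
    [proj_iso k Z] for [l = k] and killed by Schur's lemma otherwise. *)
Lemma proj_iso_nat k Y Z (f : Hom Y Z) :
  comp (proj_iso k Z) f = comp f (proj_iso k Y).
Proof.
have [L0 cov0] := finite_support Y; pose L := undup (k :: L0).
have cov l (g : Hom (X_ l) Y) : l \notin L -> g = 0.
  by rewrite mem_undup inE negb_or => /andP[_ /cov0].
have kL : k \in L by rewrite mem_undup mem_head.
rewrite -[f in LHS]compm1 (decomposition (undup_uniq _) cov) !comp_sumr.
rewrite (bigD1_seq k) ?undup_uniq //= big1 => [|l /eqP lk].
  rewrite addr0 [comp f (proj_iso k Y)]comp_sumr [LHS]comp_sumr; apply: eq_bigr => V _.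
  by rewrite !compA -[comp (comp _ f) V]compA proj_iso_id.
rewrite [comp f (proj_iso l Y)]comp_sumr [LHS]comp_sumr big1 // => V _; rewrite !compA.
by rewrite -[comp (comp _ f) V]compA proj_iso_0 ?comp0m //; move/esym.
Qed.

(** The choice behind [isotypic] is unique: two minimal projections [p] and [q] satisfy [q p = p]
    and [p q = q], and the adjoint of the first gives [p = q]. *)
Lemma isotypicE k Y : isotypic k Y = proj_iso k Y.
Proof.
have h : is_isotypic k (proj_iso k Y).
  split.
  - split; first exact: star_proj_iso.
    by rewrite [RHS]/proj_iso comp_sumr; apply: eq_bigr => V _; rewrite compA proj_iso_id.
  - by move=> f; rewrite proj_iso_nat.
  - by move=> v _; rewrite proj_iso_id.
  - move=> q _ qv; rewrite comp_sumr; apply: eq_big_seq => V Vk.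
    by rewrite compA qv //; apply: onb_isometry.
apply: xget_subset1 => // p q [[sp pp] _ pv pm] [[sq qq] _ qv qm].
have pq := pm q (conj sq qq) qv; have qp := qm p (conj sp pp) pv.
by rewrite -sp -pq star_comp sp sq qp.
Qed.

Lemma fsbigT_seq (T : choiceType) (V : nmodType) (r : seq T) (F : T -> V) :
  uniq r -> (forall i, i \notin r -> F i = 0) ->
  \sum_(i \in [set: T]) F i = \sum_(i <- r) F i.
Proof.
move=> ur h; rewrite (fsbigE r) // => [|i _]; last exact: h.
by apply: eq_bigl => i; rewrite in_setT.
Qed.

Lemma proj_iso_out k Y : (forall f : Hom (X_ k) Y, f = 0) -> proj_iso k Y = 0.
Proof. by move=> f0; rewrite /proj_iso big1 // => V _; rewrite [V]f0 comp0m. Qed.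

Variable psi : I -> R[i].
Definition Gsum Y : Hom Y Y := \sum_(k \in [set: I]) psi k *: isotypic k Y.

Lemma GsumE Y (L : seq I) : uniq L ->
  (forall k (f : Hom (X_ k) Y), k \notin L -> f = 0) ->
  Gsum Y = \sum_(k <- L) psi k *: proj_iso k Y.
Proof.
move=> uL cov; rewrite /Gsum (fsbigT_seq uL); last first.
  by move=> k kL; rewrite isotypicE proj_iso_out ?scaler0 // => f; apply: cov.
by apply: eq_bigr => k _; rewrite isotypicE.
Qed.

Lemma finite_support_uniq Y : exists L : seq I, uniq L /\
  forall k (f : Hom (X_ k) Y), k \notin L -> f = 0.
Proof.
have [L cov] := finite_support Y; exists (undup L); rewrite undup_uniq; split=> // k f.
by rewrite mem_undup; apply: cov.
Qed.

Lemma finite_support2 Y Z : exists L : seq I, [/\ uniq L,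
  forall k (f : Hom (X_ k) Y), k \notin L -> f = 0 &
  forall k (f : Hom (X_ k) Z), k \notin L -> f = 0].
Proof.
have [L cov] := finite_support Y; have [L' cov'] := finite_support Z.
exists (undup (L ++ L')); rewrite undup_uniq; split=> // k f;
  rewrite mem_undup mem_cat negb_or => /andP[? ?]; [exact: cov|exact: cov'].
Qed.

Lemma finite_support_seq (T : eqType) (Y : T -> C) (s : seq T) :
  exists L : seq I, uniq L /\
    forall t, t \in s -> forall k (f : Hom (X_ k) (Y t)), k \notin L -> f = 0.
Proof.
elim: s => [|t s [L [uL cov]]]; first by exists [::].
have [L' [uL' cov']] := finite_support_uniq (Y t).
exists (undup (L' ++ L)); rewrite undup_uniq; split=> // t'.
rewrite inE => /orP[/eqP->|ts] k f; rewrite mem_undup mem_cat negb_or => /andP[h h'].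
  exact: cov'.
exact: (cov _ ts).
Qed.

Lemma Gsum_nat Y Z (f : Hom Y Z) : comp (Gsum Z) f = comp f (Gsum Y).
Proof.
have [L [uL cY cZ]] := finite_support2 Y Z.
rewrite !(GsumE uL) // comp_suml comp_sumr; apply: eq_bigr => k _.
by rewrite compZl compZr proj_iso_nat.
Qed.

Lemma comp_Gsum Y Z (f : Hom Y Z) :
  \sum_(k \in [set: I]) psi k *: comp f (isotypic k Y) = comp f (Gsum Y).
Proof.
have [L [uL cov]] := finite_support_uniq Y.
rewrite (GsumE uL cov) comp_sumr (fsbigT_seq uL).
  by apply: eq_bigr => k _; rewrite isotypicE compZr.
by move=> k kL; rewrite isotypicE proj_iso_out ?compm0 ?scaler0 // => f'; apply: cov.
Qed.

End Semisimple.

(** * Positivity *)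

Section PositiveMatrices.
Context {R : realType}.

(** Polarization: the form is real at [x e_a + y e_b], and the pairs (1,0), (0,1), (1,1) and (1,i)
    for (x,y) determine the relation between the two entries. *)
Lemma psd_hermitian n (A : 'M[R[i]]_n) :
  (forall c : 'I_n -> R[i], 0 <= \sum_a \sum_b conjc (c a) * A a b * c b) ->
  forall a b, conjc (A a b) = A b a.
Proof.
move=> psd a b.
have q2 (x y : R[i]) : \sum_i \sum_j conjc (x * (i == a)%:R + y * (i == b)%:R) * A i j *
    (x * (j == a)%:R + y * (j == b)%:R) =
    conjc x * A a a * x + conjc x * A a b * y + conjc y * A b a * x + conjc y * A b b * y.
  have E (F : 'I_n -> R[i]) z (i : 'I_n) : \sum_j F j * (z * (j == i)%:R) = F i * z.
    rewrite (bigD1 i) //= eqxx mulr1 big1 ?addr0 // => j /negPf->.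
    by rewrite !mulr0.
  transitivity (\sum_i (conjc x * A i a * x + conjc x * A i b * y) * (i == a)%:R +
      \sum_i (conjc y * A i a * x + conjc y * A i b * y) * (i == b)%:R).
    rewrite -big_split /=; apply: eq_bigr => i _.
    under eq_bigr do rewrite mulrDr.
    rewrite big_split /= !E rmorphD !rmorphM /= !conjc_nat.
    by rewrite !mulrDl !addrA; ring.
  have E1 (F : 'I_n -> R[i]) (i : 'I_n) : \sum_j F j * (j == i)%:R = F i.
    by rewrite -[RHS]mulr1 -(E F 1); apply: eq_bigr => j _; rewrite mul1r.
  by rewrite !E1 !addrA.
have real (x y : R[i]) : conjc (conjc x * A a a * x + conjc x * A a b * y +
    conjc y * A b a * x + conjc y * A b b * y) =
    conjc x * A a a * x + conjc x * A a b * y + conjc y * A b a * x + conjc y * A b b * y.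
  by apply/CrealP; apply: ger0_real; rewrite -q2; apply: psd.
have Ii : 'i%C * 'i%C = -1 :> R[i] by rewrite -expr2 sqr_i.
have cI : conjc 'i%C = - 'i%C :> R[i] by apply/eqP; rewrite eq_complex /= oppr0 !eqxx.
have e1 := real 1 0; have e2 := real 0 1; have e3 := real 1 1; have e4 := real 1 'i%C.
have cD (x y : R[i]) : conjc (x + y) = conjc x + conjc y by exact: rmorphD.
have cM (x y : R[i]) : conjc (x * y) = conjc x * conjc y by exact: rmorphM.
have cN (x : R[i]) : conjc (- x) = - conjc x by exact: rmorphN.
move: e1 e2 e3 e4; rewrite !cI !conjc1 !conjc0.
rewrite !(mul0r, mulr0, mul1r, mulr1, add0r, addr0) !(cD, cM, cN, cI).
set u := A a b; set v := A b a; set u' := conjc u; set v' := conjc v => -> -> e3 e4.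
have e5 : u' + v' = u + v.
  by apply: subr0_eq; apply: etrans (etrans (congr1 (fun z => z - _) e3) (subrr _)); ring.
have e6 : u' - v' = v - u.
  have {}e4 : u' * - 'i%C + 'i%C * v' = u * 'i%C - 'i%C * v.
    by apply: subr0_eq; apply: etrans (etrans (congr1 (fun z => z - _) e4) (subrr _)); ring.
  have /(congr1 (fun z => 'i%C * z)) := e4.
  have -> : 'i%C * (u' * - 'i%C + 'i%C * v') = - ('i%C * 'i%C) * (u' - v') by ring.
  have -> : 'i%C * (u * 'i%C - 'i%C * v) = - ('i%C * 'i%C) * (v - u) by ring.
  by rewrite Ii opprK !mul1r.
have : u' *+ 2 = v *+ 2.
  have -> : u' *+ 2 = (u' + v') + (u' - v') by ring.
  by rewrite e5 e6; ring.
by move/eqP; rewrite eqrMn2r => /eqP.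
Qed.

(** A unitary [P] diagonalizes [A]; the diagonal entries are values of the form, hence nonnegative,
    and [B] is the root of the diagonal times [P]. *)
Lemma psd_factor n (A : 'M[R[i]]_n) :
  (forall c : 'I_n -> R[i], 0 <= \sum_a \sum_b conjc (c a) * A a b * c b) ->
  exists B : 'M[R[i]]_n, forall a b, A a b = \sum_r conjc (B r a) * B r b.
Proof.
move=> psd; have herm := psd_hermitian psd.
have At : map_mx Num.conj A^T = A by apply/matrixP => a b; rewrite !mxE; apply: herm.
have An : A \is normalmx by apply/normalmxP; rewrite At.
have /orthomx_spectral_subproof[[P D] /= uP eA] := An.
rewrite invmx_unitary // in eA.
have eAab a b : A a b = \sum_r conjc (P r a) * D 0 r * P r b.
  rewrite {1}eA mxE; apply: eq_bigr => r _; rewrite mul_mx_diag !mxE; congr (_ * _ * _).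
have D0 r : 0 <= D 0 r.
  have -> : D 0 r = \sum_a \sum_b conjc (conjc (P r a)) * A a b * conjc (P r b); last exact: psd.
  have /unitarymxP PP := uP.
  have : (P *m A *m map_mx Num.conj P^T) r r = D 0 r.
    rewrite {1}eA !mulmxA PP mul1mx -mulmxA PP mulmx1.
    by rewrite mxE eqxx mulr1n.
  move=> <-; rewrite mxE exchange_big /=; apply: eq_bigr => b _; rewrite !mxE mulr_suml.
  by apply: eq_bigr => a _; rewrite conjcK.
exists (\matrix_(r, a) (sqrtC (D 0 r) * P r a)) => a b.
rewrite eAab; apply: eq_bigr => r _; rewrite !mxE rmorphM /=.
have -> : conjc (sqrtC (D 0 r)) = sqrtC (D 0 r).
  by apply/CrealP; apply: ger0_real; rewrite sqrtC_ge0.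
by rewrite -[D 0 r in LHS]sqrtCK; ring.
Qed.

End PositiveMatrices.

Section SumsOfSquares.
Context {R : realType} {C : rigidCstarTensorCat R}.
Implicit Types X Y Z : C.

(** The subobject cut out by the zero projection. It is the empty direct sum, the base case of
    [direct_sum]. *)
Lemma zero_object : exists Z : C, idm Z = 0.
Proof.
have p0 : projection (0 : Hom (𝟙 : C) 𝟙) by split; rewrite ?star0 ?comp0m.
have [Z [v [vi v0]]] := rigid_subobjects p0; exists Z.
have e : v = 0 by rewrite -[v]compm1 -vi compA v0 comp0m.
by rewrite -vi e compm0.
Qed.

Lemma direct_sum (T : eqType) (X : T -> C) (s : seq T) : uniq s ->
  exists (Z : C) (u : forall t, Hom (X t) Z),
  [/\ forall t, t \in s -> isometry (u t),
      forall t t', t \in s -> t' \in s -> t <> t' -> comp (star (u t)) (u t') = 0 &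
      \sum_(t <- s) comp (u t) (star (u t)) = idm Z].
Proof.
elim: s => [_|t s IH /= /andP[ts us]].
  have [Z Z0] := zero_object; exists Z, (fun=> 0); split=> //.
  by rewrite big_nil Z0.
have [Z [u [ui uo uc]]] := IH us.
have [W [v [w [vi wi vw]]]] := @rigid_direct_sums _ C (X t) Z.
have wv : comp (star w) v = 0.
  have : comp (comp v (star v) + comp w (star w)) v = v by rewrite vw comp1m.
  rewrite compDl -!compA vi compm1 => /eqP; rewrite -subr_eq0 addrC addKr => /eqP e.
  by rewrite -[LHS]comp1m -wi -compA e compm0.
have vw' : comp (star v) w = 0 by rewrite -[LHS]starK star_comp starK wv star0.
pose u' := dfwith (fun i => comp w (u i)) v.
have u'in : u' t = v by rewrite /u' dfwith_in.
have u'out i : i \in s -> u' i = comp w (u i).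
  by move=> is'; rewrite /u' dfwith_out //; apply: contraNneq ts => ->.
exists W, u'; split.
- move=> i; rewrite inE => /orP[/eqP->|is']; first by rewrite u'in.
  by rewrite /isometry u'out // star_comp -compA (compA (star w)) wi comp1m ui.
- move=> i j; rewrite !inE => /orP[/eqP->|is'] /orP[/eqP->|js'] // ij.
  + by rewrite u'in u'out // compA vw' comp0m.
  + by rewrite u'in u'out // star_comp -compA wv compm0.
  + by rewrite !u'out // star_comp -compA (compA (star w)) wi comp1m uo.
- rewrite big_cons u'in -vw; congr (_ + _).
  under eq_big_seq => i is' do rewrite u'out // star_comp -compA (compA (u i)).
  by rewrite -comp_sumr -comp_suml uc comp1m.
Qed.

(* [star_pos] lets a single morphism [g] absorb all the summands. *)
Lemma sum_squares_mx_positive X n (a : 'I_n -> 'I_n -> Hom X X)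
    (s : seq {Z : C & 'I_n -> Hom X Z}) :
  (forall i j, a i j = \sum_(t <- s) comp (star (projT2 t i)) (projT2 t j)) ->
  mx_positive a.
Proof.
move=> ea.
have [W [u [ui uo uc]]] := direct_sum (fun _ : 'I_n => X) (index_enum_uniq 'I_n).
pose t i := tnth (in_tuple s) i.
have [Z [w [wi wo _]]] :=
  direct_sum (fun i : 'I_(size s) => projT1 (t i)) (index_enum_uniq _).
have {}ui j : comp (star (u j)) (u j) = idm X := ui j (mem_index_enum j).
have {}uo i j : i <> j -> comp (star (u i)) (u j) = 0.
  by apply: uo; apply: mem_index_enum.
have {}wi j : comp (star (w j)) (w j) = idm _ := wi j (mem_index_enum j).
have {}wo i j : i <> j -> comp (star (w i)) (w j) = 0.
  by apply: wo; apply: mem_index_enum.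
(* [f] is the whole family as one block matrix from [n] copies of [X] to the sum of all targets; the
   blocks of its root along [u] form the matrix required by [mx_positive]. *)
pose f := \sum_r \sum_j comp (comp (w r) (projT2 (t r) j)) (star (u j)).
have fu j : comp f (u j) = \sum_r comp (w r) (projT2 (t r) j).
  rewrite comp_suml; apply: eq_bigr => r _; rewrite comp_suml (bigD1 j) //=.
  rewrite -compA ui compm1 big1 ?addr0 // => i /eqP ij.
  by rewrite -compA uo ?compm0.
have [g fg] := star_pos f.
exists (fun k j => comp (comp (star (u k)) g) (u j)) => i j.
transitivity (comp (star (comp f (u i))) (comp f (u j))).
  rewrite ea big_tnth !fu star_sum comp_suml; apply: eq_bigr => r _.
  rewrite comp_sumr (bigD1 r) //= star_comp -compA (compA (star (w r))) wi comp1m.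
  by rewrite big1 ?addr0 // => q /eqP qr; rewrite -compA (compA (star (w r))) wo;
    rewrite ?comp0m ?compm0 // => e; apply: qr.
rewrite star_comp -compA (compA (star f)) fg -compA compA -[X in comp _ (comp X _)]comp1m -uc.
rewrite comp_suml comp_suml comp_sumr; apply: eq_bigr => k _.
by rewrite !star_comp starK !compA.
Qed.

Lemma sum_squares X (a : Hom X X) (s : seq {Z : C & Hom X Z}) :
  a = \sum_(t <- s) comp (star (projT2 t)) (projT2 t) ->
  exists g : Hom X X, a = comp (star g) g.
Proof.
move=> ea; pose s' := [seq existT (fun Z => 'I_1 -> Hom X Z) (projT1 t) (fun=> projT2 t) | t <- s].
have [b /(_ ord0 ord0)] : mx_positive (fun _ _ : 'I_1 => a).
  by apply: (@sum_squares_mx_positive _ _ _ s') => i j; rewrite big_map.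
by rewrite big_ord1 => ->; exists (b ord0 ord0).
Qed.

Variable S : choices C.

(** On the isotypic component of [X_k], [T] is a scalar matrix in the basis [onb k Y], positive
    semidefinite by hypothesis. [psd_factor] turns it into a sum of squares, and [sum_squares]
    merges the components. *)
Lemma psd_square Y (T : Hom Y Y) :
  (forall k (f : Hom (rep (c := S) k) Y), 0 <= scalar_of (comp (star f) (comp T f))) ->
  exists g : Hom Y Y, T = comp (star g) g.
Proof.
move=> psd; have [L [uL cov]] := finite_support_uniq S Y.
pose n k := size (onb (c := S) k Y); pose e k i := (onb (c := S) k Y)`_i.
have proj k : exists h : 'I_(n k) -> Hom Y (rep k),
    comp T (proj_iso k Y) = \sum_i comp (star (h i)) (h i).
  pose A : 'M[R[i]]_(n k) := \matrix_(a, b) scalar_of (comp (star (e k a)) (comp T (e k b))).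
  have [c|B BA] := @psd_factor _ _ A.
    have := psd k (\sum_a c a *: e k a).
    rewrite star_sum comp_suml comp_sumr.
    have -> : scalar_of (\sum_i comp (star (c i *: e k i)) (\sum_j comp T (c j *: e k j))) =
       \sum_i \sum_j conjc (c i) * A i j * c j; last by [].
    rewrite /scalar_of linear_sum; apply: eq_bigr => i _.
    rewrite comp_sumr linear_sum; apply: eq_bigr => j _.
    rewrite starZ compZr compZl compZr !linearZ /= !mxE mulrA -mulrA mulrC.
    by rewrite -mulrA [_ * c j]mulrC mulrA mulrC mulrA.
  exists (fun r => \sum_b B r b *: star (e k b)).
  transitivity (\sum_a \sum_b A a b *: comp (e k a) (star (e k b))).
    have -> : comp T (proj_iso k Y) = comp (proj_iso k Y) (comp T (proj_iso k Y)).
      rewrite compA proj_iso_nat -compA; congr comp.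
      by rewrite comp_sumr; apply: eq_bigr => V _; rewrite compA proj_iso_id.
    rewrite {1}/proj_iso (big_nth 0) big_mkord comp_suml; apply: eq_bigr => a _.
    rewrite /proj_iso (big_nth 0) big_mkord comp_sumr comp_sumr; apply: eq_bigr => b _.
    rewrite -compA (compA T) (compA (star _)) -/(e k a) -/(e k b).
    by rewrite [comp (star _) _](scalar_ofE _ (rep_simple k)) compZl comp1m compZr mxE.
  under eq_bigr => a _ do under eq_bigr => b _ do rewrite BA scaler_suml.
  under eq_bigr => a _ do rewrite exchange_big /=.
  rewrite exchange_big /=; apply: eq_bigr => r _.
  rewrite star_sum comp_suml; apply: eq_bigr => a _.
  rewrite comp_sumr; apply: eq_bigr => b _.
  by rewrite starZ starK compZl compZr scalerA.
pose h k := projT1 (cid (proj k)).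
have hE k : comp T (proj_iso k Y) = \sum_i comp (star (h k i)) (h k i) :=
  projT2 (cid (proj k)).
pose s := flatten [seq [seq existT (fun Z : C => Hom Y Z) (rep k) (h k i) |
  i <- index_enum 'I_(n k)] | k <- L].
apply: (@sum_squares _ _ s).
rewrite -[LHS]compm1 (decomposition uL cov) comp_sumr /s big_flatten big_map.
by apply: eq_bigr => k _; rewrite hE big_map.
Qed.

End SumsOfSquares.

(** * The maps Theta^psi as twists by a natural transformation *)

Section ThetaTwist.
Context {R : realType} {C : rigidCstarTensorCat R} (S : choices C).
Variable psi : Irr S -> R[i].
Local Notation G := (Gsum psi).

Lemma hatE a b (x : Hom (a ⊗ b) (a ⊗ b)) :
  Arr (hat S x) = bend (solb S b) (conj_ob S a ⊗ a) (flat (sol S a) b (Arr x)).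
Proof.
by rewrite /hat !ArrE bend.unlock flat.unlock whiskr //= tobA.
Qed.

Lemma hat_inj a b : injective (@hat _ _ S a b).
Proof.
move=> x y /(congr1 (@Arr _ _ _ _)); rewrite !hatE.
move/(bend_inj (sol_conj S b) (b := b)) => e; apply: Arr_inj.
apply: (flat_inj (sol_conj S a) (b := b)) => //.
by apply: e; obj.
Qed.

(** [hat] is [flat] followed by [bend], and [bend] commutes with precomposition on [conj_ob a ⊗ a].
    The defining equation thus loses the conjugate of [b], and injectivity of [hat] makes its
    solution unique. *)
Lemma ThetaE a b (x : Hom (a ⊗ b) (a ⊗ b)) :
  Theta psi x = twist G (sol S a) (solb S a) x.
Proof.
pose P := [set y : Hom (a ⊗ b) (a ⊗ b) | hat S y = \sum_(k \in [set: Irr S])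
  psi k *: comp (hat S x) (isotypic k (conj_ob S a ⊗ a))]%classic.
have Pt : P (twist G (sol S a) (solb S a) x).
  rewrite /P /= comp_Gsum; apply: (@Arr_inj _ C); rewrite Arr_comp !hatE.
  rewrite (flat_twist _ (sol_conj S a)) -[X in bend _ X (_ • _)]/(dom (Arr (G (conj_ob S a ⊗ a)))).
  by rewrite bend_comp //; obj.
by apply: xget_unique => // y Py; apply: hat_inj; rewrite (Pt : hat S _ = _).
Qed.

(** Valid for every [psi], so admissibility comes down to the normalization and complete
    positivity. *)
Lemma Theta_multiplier : is_multiplier (Theta psi).
Proof.
have Gnat := Gsum_nat psi; split.
- by move=> a b c x y; rewrite !ThetaE twist_linear.
- by move=> a b f f' g g' x; rewrite !ThetaE (twist_natural Gnat (sol_conj S a)) //; apply: sol_conj.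
- move=> a1 a2 b1 b2 x; rewrite !ThetaE; apply: (@Arr_inj _ C).
  rewrite (twist_tensor Gnat (sol_conj S a2) (sol_conj S _) (erefl _) (x := x)) ?ArrE ?atenA //.
Qed.

End ThetaTwist.

Section ArrowScalars.
Context {R : realType} {C : tensorCat R}.
Implicit Types X Y : C.

Lemma Arr_scalar X (f : Hom X X) : simple X -> Arr f = ascale (scalar_of f) (aid X).
Proof. by move=> sX; rewrite {1}(scalar_ofE f sX). Qed.

Lemma Arr_star_comp X Y (f g : Hom X Y) : simple X ->
  (Arr f)^* • Arr g = ascale (scalar_of (comp (star f) g)) (aid X).
Proof. by move=> sX; rewrite -Arr_scalar // Arr_comp. Qed.

Lemma Arr_comp_star X Y (f g : Hom X Y) : simple Y ->
  Arr f • (Arr g)^* = ascale (scalar_of (comp f (star g))) (aid Y).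
Proof. by move=> sX; rewrite -Arr_scalar // Arr_comp. Qed.

End ArrowScalars.

(** * Sphericality *)

Section Sphericality.
Context {R : realType} {C : tensorCat R}.
Context {X Xb Z Zb : C} {r : Hom 𝟙 (Xb ⊗ X)} {rb : Hom 𝟙 (X ⊗ Xb)}.
Context {rZ : Hom 𝟙 (Zb ⊗ Z)} {rbZ : Hom 𝟙 (Z ⊗ Zb)}.
Hypotheses (D : conjugate_eqs r rb) (DZ : conjugate_eqs rZ rbZ).
Hypotheses (sX : simple X) (sXb : simple Xb).
Variable d : R[i].
Hypotheses (d0 : d != 0) (rd : comp (star r) r = d *: idm 𝟙)
  (rbd : comp (star rb) rb = d *: idm 𝟙).

Definition ltr (M : Hom Z Z) : arrow := (Arr rZ)^* • (aid Zb ⊙ Arr M) • Arr rZ.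
Definition rtr (M : Hom Z Z) : arrow := (Arr rbZ)^* • (Arr M ⊙ aid Zb) • Arr rbZ.
Hypothesis trE : forall M, ltr M = rtr M.

(** The left and the right transpose of [V], obtained by bending it around one side or the other. *)
Let J (V : Hom X Z) : Hom Zb Xb :=
  typed _ _ (bend rb Zb ((Arr rZ)^* • (aid Zb ⊙ Arr V))).
Let J' (V : Hom X Z) : Hom Zb Xb :=
  typed _ _ (sharp r Zb ((Arr rbZ)^* • (Arr V ⊙ aid Zb))).

Let ArrJ V : Arr (J V) = bend rb Zb ((Arr rZ)^* • (aid Zb ⊙ Arr V)).
Proof. by rewrite Arr_typed //; obj. Qed.
Let ArrJ' V : Arr (J' V) = sharp r Zb ((Arr rbZ)^* • (Arr V ⊙ aid Zb)).
Proof. by rewrite Arr_typed //; obj. Qed.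

Let evalJ V : (Arr rZ)^* • (aid Zb ⊙ Arr V) = (Arr r)^* • (Arr (J V) ⊙ aid X).
Proof.
by rewrite ArrJ -[LHS](bendK D (b := 𝟙) (c := Zb)) // unbend.unlock aten1l.
Qed.

Let evalJ' V : (Arr rbZ)^* • (Arr V ⊙ aid Zb) = (Arr rb)^* • (aid X ⊙ Arr (J' V)).
Proof.
by rewrite ArrJ' -[LHS](sharpK (conjugate_sym D) (b := 𝟙) (c := Zb)) // flat.unlock aten1r.
Qed.

Let bend_eval : bend rb Xb (Arr r)^* = aid Xb.
Proof. by rewrite bend.unlock (zigY D). Qed.

Let J_surj U : exists V, J V = U.
Proof.
pose t := sharp rbZ X ((Arr r)^* • (Arr U ⊙ aid X)).
have dt : dom t = X by rewrite /t; obj.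
have ct : cod t = Z by rewrite /t; obj.
exists (typed X Z t); apply: Arr_inj; rewrite ArrJ Arr_typed //.
have -> : (Arr rZ)^* • (aid Zb ⊙ t) = (Arr r)^* • (Arr U ⊙ aid X).
  by rewrite -[RHS](sharpK DZ (b := 𝟙) (c := X)) // flat.unlock aten1r.
by rewrite (bend_comp rb (t := (Arr r)^*) (f := Arr U)) // bend_eval acomp1m.
Qed.

(** Taking adjoints exchanges the two transposes: the adjoint of [J' V] is the left transpose of
    [star V]. *)
Let eval_J'star V : (Arr rZ)^* • ((Arr (J' V))^* ⊙ aid Z) = (Arr r)^* • (aid Xb ⊙ (Arr V)^*).
Proof.
rewrite ArrJ' sharp.unlock !astarE whiskr; last by obj.
rewrite acompA atenA -aid_tob.
have -> : (Arr rZ)^* • ((Arr r)^* ⊙ aid (Zb ⊗ Z)) = (Arr r)^* • (aid (Xb ⊗ X) ⊙ (Arr rZ)^*).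
  by have := slide (Arr r)^* (Arr rZ)^*; rewrite /= aten1r aten1l.
rewrite -acompA aid_tob !atenA -whiskl; last obj.
congr (_ • (_ ⊙ _)).
rewrite whiskr // acompA atenA -aid_tob.
have -> : (aid X ⊙ (Arr rZ)^*) • ((Arr V)^* ⊙ aid (Zb ⊗ Z)) = (Arr V)^* • (aid Z ⊙ (Arr rZ)^*).
  by have := slide (Arr V)^* (Arr rZ)^*; rewrite /= aten1r.
by rewrite -acompA (zagX DZ) acompm1.
Qed.

(** Transposition reverses composition, so this is the left transpose of [star V' V], a scalar
    because [X] is simple. *)
Let J_J'star V V' : comp (J V) (star (J' V')) = scalar_of (comp (star V') V) *: idm Xb.
Proof.
apply: (@Arr_inj _ C); rewrite Arr_comp Arr_star ArrJ.
have := bend_comp rb (t := (Arr rZ)^* • (aid Zb ⊙ Arr V)) (f := (Arr (J' V'))^*) (erefl _).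
rewrite /= => <-; rewrite -acompA.
have -> : (aid Zb ⊙ Arr V) • ((Arr (J' V'))^* ⊙ aid X) =
    ((Arr (J' V'))^* ⊙ aid Z) • (aid Xb ⊙ Arr V).
  by rewrite [RHS](slide (Arr (J' V'))^* (Arr V)).
rewrite acompA eval_J'star -acompA -whiskl // Arr_star_comp //.
rewrite aten_scaler ascaler -aid_tob acompm1 //.
by rewrite Arr_scale Arr_id -bend_eval bend.unlock aten_scalel ascalel.
Qed.

Let B (f g : Hom Zb Xb) : R[i] := scalar_of (comp f (star g)).

Let BDl f f' g : B (f + f') g = B f g + B f' g.
Proof. by rewrite /B compDl /scalar_of linearD. Qed.
Let BNl f g : B (- f) g = - B f g.
Proof. by apply/eqP; rewrite -subr_eq0 opprK -BDl addNr /B comp0m /scalar_of linear0. Qed.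
Let Bsym f g : B f g = conjc (B g f).
Proof. by rewrite /B -scalar_of_star // star_comp starK. Qed.
Let BDr f g g' : B f (g + g') = B f g + B f g'.
Proof. by rewrite Bsym BDl rmorphD /= -!Bsym. Qed.
Let BNr f g : B f (- g) = - B f g.
Proof. by rewrite Bsym BNl rmorphN /= -!Bsym. Qed.
Let B_ge0 f : 0 <= B f f.
Proof. by rewrite /B -[X in comp X]starK; apply: scalar_of_ge0. Qed.
Let B_eq0 f : B f f = 0 -> f = 0.
Proof.
rewrite /B -[X in comp X]starK => /(scalar_of_eq0 sXb) e.
by rewrite -[f]starK e star0.
Qed.

(** Sliding [V] and [star V'] over the cap and the cup leaves a loop of value [d] with the scalar
    [J V star (J V')] on its strand [Xb]. *)
Let ltrB V V' : ltr (comp V (star V')) = Arr ((B (J V) (J V') * d) *: idm 𝟙).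
Proof.
rewrite /ltr Arr_comp Arr_star whiskl //.
have -> : aid Zb ⊙ (Arr V')^* = (aid Zb ⊙ Arr V')^* by rewrite !astarE.
rewrite acompA -[X in X = _]acompA -{2}[Arr rZ]astarK -astar_comp !evalJ.
rewrite astar_comp astar_ten astar_id astarK -acompA (acompA (_ ⊙ _)) -whiskr //.
rewrite Arr_comp_star // aten_scalel -aid_tob ascalel ascaler acomp1m //.
by rewrite -Arr_star -Arr_comp rd /ascale /= scalerA.
Qed.

Let rtrB V V' : rtr (comp V (star V')) = Arr ((B (J' V) (J' V') * d) *: idm 𝟙).
Proof.
rewrite /rtr Arr_comp Arr_star whiskr //.
have -> : (Arr V')^* ⊙ aid Zb = (Arr V' ⊙ aid Zb)^* by rewrite !astarE.
rewrite acompA -[X in X = _]acompA -{2}[Arr rbZ]astarK -astar_comp !evalJ'.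
rewrite astar_comp astar_ten astar_id astarK -acompA (acompA (_ ⊙ _)) -whiskl //.
rewrite Arr_comp_star // aten_scaler -aid_tob ascalel ascaler acomp1m //.
by rewrite -Arr_star -Arr_comp rbd /ascale /= scalerA.
Qed.

Let BJJ' V V' : B (J V) (J V') = B (J' V) (J' V').
Proof.
have := trE (comp V (star V')); rewrite ltrB rtrB => /Arr_inj/eqP.
rewrite -subr_eq0 -scalerBl scaler_eq0 -mulrBl mulf_eq0 (negPf d0) orbF subr_eq0.
by case/orP=> /eqP // /(simple_id (unit_simple C)).
Qed.

Let A (V V' : Hom X Z) : R[i] := scalar_of (comp (star V') V).

Let BA V V' : B (J V) (J' V') = A V V'.
Proof. by rewrite /B J_J'star scalar_ofZ. Qed.

(* [J] and [J'] are dual to each other for [B] and isometric to each other, and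
   [J] is onto: for [J V' = J V - J' V] one finds [J' V' = - J V'], so that
   [A V' V' = - B (J V') (J V')] and both vanish. *)
Let J_eq V : J V = J' V.
Proof.
have [δ eδ] : exists δ, δ = J V - J' V by eexists.
have [V' eV'] := J_surj δ.
have e1 W : B (J' W) δ = - B (J W) δ.
  rewrite eδ !BDr !BNr BA -!BJJ' opprD opprK addrC; congr (- _ + _).
  by rewrite Bsym BA /A -scalar_of_star // star_comp starK.
have e2 := e1 V'; rewrite eV' in e2.
have dr : conjc (B δ δ) = B δ δ by rewrite -Bsym.
have e3 : J' V' = - δ.
  apply/eqP; rewrite -subr_eq0 opprK; apply/eqP/B_eq0.
  rewrite !BDl !BDr e2 -BJJ' eV' [B δ (J' V')]Bsym e2 rmorphN /= dr.
  by ring.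
have : A V' V' = - B δ δ by rewrite -BA eV' e3 BNr.
move=> e4; have := scalar_of_ge0 V' sX; rewrite -/(A V' V') e4 oppr_ge0 => le0.
apply: subr0_eq; rewrite -eδ; apply: B_eq0.
by apply/eqP; rewrite eq_le le0 B_ge0.
Qed.

Lemma simple_trace (V V' : Hom X Z) :
  ltr (comp V (star V')) = Arr ((d * scalar_of (comp (star V') V)) *: idm 𝟙).
Proof. by rewrite ltrB [in X in B _ X]J_eq BA mulrC. Qed.

End Sphericality.

(** * Conjugates of tensor products and the mixed trace *)

Section TensorDual.
Context {R : realType} {C : tensorCat R}.

Lemma conjugate_of_arrows (X Y : C) (r : Hom 𝟙 (Y ⊗ X)) (rb : Hom 𝟙 (X ⊗ Y)) :
  ((Arr rb)^* ⊙ aid X) • (aid X ⊙ Arr r) = aid X ->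
  ((Arr r)^* ⊙ aid Y) • (aid Y ⊙ Arr rb) = aid Y -> conjugate_eqs r rb.
Proof. by move=> e e'; split; apply: (@Arr_inj R C); rewrite !ArrE. Qed.

(** The interchange law separates the nested bends, and each is straightened by its own conjugate
    equation. *)
Lemma tensor_zig (A Ab B Bb : C) (rA : Hom 𝟙 (Ab ⊗ A)) (rbA : Hom 𝟙 (A ⊗ Ab))
    (rB : Hom 𝟙 (Bb ⊗ B)) (rbB : Hom 𝟙 (B ⊗ Bb)) :
  conjugate_eqs rA rbA -> conjugate_eqs rB rbB ->
  (((aid A ⊙ Arr rbB ⊙ aid Ab) • Arr rbA)^* ⊙ aid (A ⊗ B)) •
  (aid (A ⊗ B) ⊙ ((aid Bb ⊙ Arr rA ⊙ aid B) • Arr rB)) = aid (A ⊗ B).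
Proof.
move=> DA DB; rewrite !astarE whiskr; last obj.
rewrite whiskl; last obj.
rewrite !aid_tob !atenA -!acompA.
have e : ((Arr rbB)^* ⊙ aid Ab ⊙ aid A ⊙ aid B) • (aid B ⊙ aid Bb ⊙ Arr rA ⊙ aid B) =
    (Arr rA ⊙ aid B) • ((Arr rbB)^* ⊙ aid B).
  by have := slide (Arr rbB)^* (Arr rA ⊙ aid B); rewrite /= aten1l tob1l !aid_tob !atenA.
have -> : (aid A ⊙ (Arr rbB)^* ⊙ aid Ab ⊙ aid A ⊙ aid B) •
    ((aid A ⊙ aid B ⊙ aid Bb ⊙ Arr rA ⊙ aid B) • (aid A ⊙ aid B ⊙ Arr rB)) =
    aid A ⊙ Arr rA ⊙ aid B.
  rewrite acompA -[X in X • _]whiskl; last obj.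
  rewrite e -whiskl; last obj.
  by rewrite -acompA (zigX DB) acompm1 //; obj.
by rewrite -!atenA -whiskr ?(zigX DA) //; obj.
Qed.

Lemma tensor_conjugate (A Ab B Bb : C) (rA : Hom 𝟙 (Ab ⊗ A)) (rbA : Hom 𝟙 (A ⊗ Ab))
    (rB : Hom 𝟙 (Bb ⊗ B)) (rbB : Hom 𝟙 (B ⊗ Bb))
    (r : Hom 𝟙 ((Bb ⊗ Ab) ⊗ (A ⊗ B))) (rb : Hom 𝟙 ((A ⊗ B) ⊗ (Bb ⊗ Ab))) :
  conjugate_eqs rA rbA -> conjugate_eqs rB rbB ->
  Arr r = (aid Bb ⊙ Arr rA ⊙ aid B) • Arr rB ->
  Arr rb = (aid A ⊙ Arr rbB ⊙ aid Ab) • Arr rbA ->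
  conjugate_eqs r rb.
Proof.
move=> DA DB er erb; apply: conjugate_of_arrows; rewrite er erb.
  exact: tensor_zig.
by apply: tensor_zig; apply: conjugate_sym.
Qed.

End TensorDual.

Section MixedTrace.
Context {R : realType} {C : tensorCat R}.

(* The categorical trace on [Y1 ⊗ X2], with [Y1] closed on its left and [X2] on
   its right. *)
Definition mixtr (X1 Y1 X2 Y2 : C) (rb1 : Hom 𝟙 (X1 ⊗ Y1)) (rb2 : Hom 𝟙 (X2 ⊗ Y2))
    (M : arrow (C := C)) : arrow :=
  ((Arr rb1)^* ⊙ (Arr rb2)^*) • (aid X1 ⊙ M ⊙ aid Y2) • (Arr rb1 ⊙ Arr rb2).

Context {X1 Y1 X2 Y2 : C} {r1 : Hom 𝟙 (Y1 ⊗ X1)} {rb1 : Hom 𝟙 (X1 ⊗ Y1)}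
  {r2 : Hom 𝟙 (Y2 ⊗ X2)} {rb2 : Hom 𝟙 (X2 ⊗ Y2)}.
Hypotheses (D1 : conjugate_eqs r1 rb1) (D2 : conjugate_eqs r2 rb2).

Section SimpleFactors.
Hypotheses (sY1 : simple Y1) (sX2 : simple X2).
Variables d1 d2 : R[i].
Hypotheses (r1d : comp (star r1) r1 = d1 *: idm 𝟙) (rb1d : comp (star rb1) rb1 = d1 *: idm 𝟙).
Hypotheses (r2d : comp (star r2) r2 = d2 *: idm 𝟙) (rb2d : comp (star rb2) rb2 = d2 *: idm 𝟙).

Let rZ : Hom 𝟙 ((Y2 ⊗ X1) ⊗ (Y1 ⊗ X2)) := typed _ _ ((aid Y2 ⊙ Arr rb1 ⊙ aid X2) • Arr r2).
Let rbZ : Hom 𝟙 ((Y1 ⊗ X2) ⊗ (Y2 ⊗ X1)) := typed _ _ ((aid Y1 ⊙ Arr rb2 ⊙ aid X1) • Arr r1).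
Let ArrZ : Arr rZ = (aid Y2 ⊙ Arr rb1 ⊙ aid X2) • Arr r2.
Proof. by rewrite Arr_typed //; obj. Qed.
Let ArrbZ : Arr rbZ = (aid Y1 ⊙ Arr rb2 ⊙ aid X1) • Arr r1.
Proof. by rewrite Arr_typed //; obj. Qed.
Let DZ : conjugate_eqs rZ rbZ.
Proof. exact: tensor_conjugate (conjugate_sym D1) D2 ArrZ ArrbZ. Qed.

(** Tracing out [Y1] leaves an endomorphism [N] of the simple object [X2], a scalar. It may be
    closed on either side since both loops have the value [d2]. *)
Let ltrM M : ltr (rZ := rZ) M = mixtr rb1 rb2 (Arr M).
Proof.
pose N := typed X2 X2 (((Arr rb1)^* ⊙ aid X2) • (aid X1 ⊙ Arr M) • (Arr rb1 ⊙ aid X2)).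
have NE : Arr N = ((Arr rb1)^* ⊙ aid X2) • (aid X1 ⊙ Arr M) • (Arr rb1 ⊙ aid X2).
  by rewrite Arr_typed //; obj.
have -> : ltr (rZ := rZ) M = (Arr r2)^* • (aid Y2 ⊙ Arr N) • Arr r2.
  rewrite /ltr ArrZ NE !astarE whiskl; last obj.
  rewrite whiskl; last obj.
  by rewrite aid_tob !atenA !acompA.
have -> : mixtr rb1 rb2 (Arr M) = (Arr rb2)^* • (Arr N ⊙ aid Y2) • Arr rb2.
  rewrite /mixtr NE whiskr; last obj.
  rewrite whiskr; last obj.
  have -> : Arr rb1 ⊙ Arr rb2 = ((Arr rb1 ⊙ aid X2) ⊙ aid Y2) • Arr rb2.
    by rewrite [LHS]aten_l /= aten1l aid_tob atenA.
  have -> : (Arr rb1)^* ⊙ (Arr rb2)^* = (Arr rb2)^* • (((Arr rb1)^* ⊙ aid X2) ⊙ aid Y2).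
    by rewrite [LHS]aten_r /= aten1l aid_tob atenA.
  by rewrite !atenA !acompA.
rewrite (Arr_scalar N sX2) aten_scaler aten_scalel -!aid_tob !ascaler !ascalel !acompm1 //.
by rewrite -!Arr_star -!Arr_comp r2d rb2d.
Qed.

Let rtrM M : rtr (rbZ := rbZ) M = mixtr rb1 rb2 (Arr M).
Proof.
pose N := typed Y1 Y1 ((aid Y1 ⊙ (Arr rb2)^*) • (Arr M ⊙ aid Y2) • (aid Y1 ⊙ Arr rb2)).
have NE : Arr N = (aid Y1 ⊙ (Arr rb2)^*) • (Arr M ⊙ aid Y2) • (aid Y1 ⊙ Arr rb2).
  by rewrite Arr_typed //; obj.
have -> : rtr (rbZ := rbZ) M = (Arr r1)^* • (Arr N ⊙ aid X1) • Arr r1.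
  rewrite /rtr ArrbZ NE !astarE whiskr; last obj.
  rewrite whiskr; last obj.
  by rewrite aid_tob !atenA !acompA.
have -> : mixtr rb1 rb2 (Arr M) = (Arr rb1)^* • (aid X1 ⊙ Arr N) • Arr rb1.
  rewrite /mixtr NE whiskl; last obj.
  rewrite whiskl; last obj.
  have -> : Arr rb1 ⊙ Arr rb2 = (aid X1 ⊙ aid Y1 ⊙ Arr rb2) • Arr rb1.
    by rewrite [LHS]aten_r /= aten1r aid_tob atenA.
  have -> : (Arr rb1)^* ⊙ (Arr rb2)^* = (Arr rb1)^* • (aid X1 ⊙ aid Y1 ⊙ (Arr rb2)^*).
    by rewrite [LHS]aten_l /= aten1r aid_tob atenA.
  by rewrite !acompA.
rewrite (Arr_scalar N sY1) aten_scaler aten_scalel -!aid_tob !ascaler !ascalel !acompm1 //.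
by rewrite -!Arr_star -!Arr_comp r1d rb1d.
Qed.

Lemma mixed_trace (X Xb : C) (r : Hom 𝟙 (Xb ⊗ X)) (rb : Hom 𝟙 (X ⊗ Xb)) d
    (V V' : Hom X (Y1 ⊗ X2)) :
  conjugate_eqs r rb -> simple X -> simple Xb -> d != 0 ->
  comp (star r) r = d *: idm 𝟙 -> comp (star rb) rb = d *: idm 𝟙 ->
  mixtr rb1 rb2 (Arr (comp V (star V'))) =
  Arr ((d * scalar_of (comp (star V') V)) *: idm 𝟙).
Proof.
move=> D sX sXb d0 rd rbd; rewrite -ltrM (simple_trace D DZ sX sXb d0 rd rbd) // => M.
by rewrite ltrM rtrM.
Qed.

End SimpleFactors.

(* The strand [Y1] carries the adjoint of [f], bent around as in the involution
   of the tube algebra. *)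
Definition bent (m : C) (f : Hom X1 (m ⊗ X1)) : arrow :=
  ((Arr r1)^* ⊙ aid Y1) • (aid Y1 ⊙ (Arr f)^* ⊙ aid Y1) • (aid Y1 ⊙ aid m ⊙ Arr rb1).

(** [bent f] is the [flat] of the right-hand side, and composing it with the cup is [sharp]. *)
Lemma bent_cup (m : C) (f : Hom X1 (m ⊗ X1)) :
  (aid X1 ⊙ bent f) • (Arr rb1 ⊙ aid m) = ((Arr f)^* ⊙ aid Y1) • (aid m ⊙ Arr rb1).
Proof.
pose t := typed m (X1 ⊗ Y1) (((Arr f)^* ⊙ aid Y1) • (aid m ⊙ Arr rb1)).
have et : Arr t = ((Arr f)^* ⊙ aid Y1) • (aid m ⊙ Arr rb1).
  by rewrite Arr_typed //; obj.
rewrite -et -(flatK D1 (b := Y1) (c := m) (t := Arr t)) // sharp.unlock flat.unlock.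
by rewrite et [aid Y1 ⊙ (_ • _)]whiskl ?acompA //; obj.
Qed.

Variable G : forall Y : C, Hom Y Y.

Definition cup_twist : Hom (X2 ⊗ Y2) (X1 ⊗ Y1) := twist G r1 rb1 (comp rb1 (star rb2)).

Lemma Arr_cup_twist : Arr cup_twist =
  (aid X1 ⊙ ((aid Y1 ⊙ (Arr rb2)^*) • (Arr (G (Y1 ⊗ X2)) ⊙ aid Y2))) •
  (Arr rb1 ⊙ aid (X2 ⊗ Y2)).
Proof.
rewrite Arr_twist sharp.unlock; congr ((_ ⊙ (_ • _)) • _).
by rewrite Arr_comp flat_comp flat.unlock (zigY D1) acomp1m //; obj.
Qed.

(** An isotopy: the adjoint of [f1] is pulled around the cup by [bent_cup] and slides past [G],
    which sits on other strands. *)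
Lemma cup_twist_trace (m : C) (f1 : Hom X1 (m ⊗ X1)) (f2 : Hom X2 (m ⊗ X2)) :
  ((Arr f1 ⊙ aid Y1) • Arr rb1)^* • (aid m ⊙ Arr cup_twist) • ((Arr f2 ⊙ aid Y2) • Arr rb2) =
  mixtr rb1 rb2 (Arr (G (Y1 ⊗ X2)) • ((bent f1 ⊙ aid X2) • (aid Y1 ⊙ Arr f2))).
Proof.
pose F1 := (Arr f1)^*; pose c1 := (Arr rb1)^*; pose c2 := (Arr rb2)^*.
pose GG := Arr (G (Y1 ⊗ X2)); pose h2 := (Arr f2 ⊙ aid Y2) • Arr rb2.
have e1 : (aid X1 ⊙ aid Y1 ⊙ Arr f2 ⊙ aid Y2) • (Arr rb1 ⊙ Arr rb2) =
    (Arr rb1 ⊙ aid m ⊙ aid X2 ⊙ aid Y2) • h2.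
  rewrite -atenA -aid_tob aten_comp // acomp1m // -/h2 [LHS]aten_l /= aten1l.
  by rewrite !aid_tob !atenA.
have e2 : (aid X1 ⊙ bent f1 ⊙ aid X2 ⊙ aid Y2) • (Arr rb1 ⊙ aid m ⊙ aid X2 ⊙ aid Y2) =
    (F1 ⊙ aid Y1 ⊙ aid X2 ⊙ aid Y2) • (aid m ⊙ Arr rb1 ⊙ aid X2 ⊙ aid Y2).
  have /(congr1 (fun t => t ⊙ aid (X2 ⊗ Y2))) := bent_cup f1.
  rewrite !whiskr ?aid_tob ?atenA //; first by obj.
  by rewrite /bent; obj.
have e3 : c1 • ((F1 ⊙ aid Y1) • (aid m ⊙ aid X1 ⊙ aid Y1 ⊙ c2)) =
    (c1 ⊙ c2) • (F1 ⊙ aid Y1 ⊙ aid X2 ⊙ aid Y2).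
  transitivity ((c1 • (F1 ⊙ aid Y1)) ⊙ c2).
    by rewrite [RHS]aten_l /= aten1r !aid_tob !atenA acompA.
  have -> : F1 ⊙ aid Y1 ⊙ aid X2 ⊙ aid Y2 = (F1 ⊙ aid Y1) ⊙ aid (X2 ⊗ Y2).
    by rewrite aid_tob atenA.
  by rewrite aten_comp // acompm1.
have e4 : (F1 ⊙ aid Y1 ⊙ aid X2 ⊙ aid Y2) • (aid m ⊙ aid X1 ⊙ GG ⊙ aid Y2) =
    (aid X1 ⊙ GG ⊙ aid Y2) • (F1 ⊙ aid Y1 ⊙ aid X2 ⊙ aid Y2).
  by have := slide F1 (GG ⊙ aid Y2); rewrite /= !aid_tob !atenA.
rewrite /mixtr Arr_cup_twist !astarE -/h2 -/GG -/c1 -/c2 -/F1.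
have -> : aid m ⊙ ((aid X1 ⊙ ((aid Y1 ⊙ c2) • (GG ⊙ aid Y2))) • (Arr rb1 ⊙ aid (X2 ⊗ Y2))) =
    (aid m ⊙ aid X1 ⊙ aid Y1 ⊙ c2) • (aid m ⊙ aid X1 ⊙ GG ⊙ aid Y2) •
    (aid m ⊙ Arr rb1 ⊙ aid X2 ⊙ aid Y2).
  rewrite whiskl; last obj.
  rewrite [aid X1 ⊙ (_ • _)]whiskl; last obj.
  by rewrite whiskl ?aid_tob //; obj.
have -> : aid X1 ⊙ (GG • ((bent f1 ⊙ aid X2) • (aid Y1 ⊙ Arr f2))) ⊙ aid Y2 =
    (aid X1 ⊙ GG ⊙ aid Y2) • ((aid X1 ⊙ bent f1 ⊙ aid X2 ⊙ aid Y2) •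
    (aid X1 ⊙ aid Y1 ⊙ Arr f2 ⊙ aid Y2)).
  rewrite whiskr; last by rewrite /bent; obj.
  rewrite whiskl; last by rewrite /bent; obj.
  rewrite whiskr; last by rewrite /bent; obj.
  rewrite whiskl; last by rewrite /bent; obj.
  by rewrite !atenA.
rewrite -!acompA e1 (acompA (F1 ⊙ aid Y1)) (acompA c1) e3 -!acompA.
rewrite (acompA (F1 ⊙ _)) e4 -!acompA (acompA (aid X1 ⊙ bent f1 ⊙ _)) e2.
by rewrite -!acompA.
Qed.

End MixedTrace.

(** * Norms, dimensions and conjugates of simple objects *)

Section Norms.
Context {R : realType} {C : cstarCat R}.
Implicit Types X Y : C.

Lemma nrm_ge0 X Y (f : Hom X Y) : 0 <= nrm f.
Proof.
have := nrm_triangle f (- f); rewrite subrr nrm0.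
have -> : nrm (- f) = nrm f.
  have := nrm_scale (-1) f; rewrite scaleN1r normrN1 mul1r => -[].
  by [].
by rewrite -mulr2n pmulrn_lge0.
Qed.

Lemma nrm_id X : idm X <> 0 -> nrm (idm X) = 1.
Proof.
move=> X0; have := nrm_cstar (idm X); rewrite star1 comp1m expr2 => e.
have n0 : nrm (idm X) != 0 by apply/eqP => /nrm_eq0.
by apply: (mulIf n0); rewrite mul1r -e.
Qed.

Lemma star_comp_nrm X Y (f : Hom X Y) : simple X ->
  comp (star f) f = (nrm f ^+ 2)%:C *: idm X.
Proof.
move=> sX; rewrite [LHS](scalar_ofE _ sX); congr (_ *: _).
have ge := scalar_of_ge0 f sX; rewrite -nrm_cstar [in RHS](scalar_ofE (comp _ _) sX).
by rewrite nrm_scale (nrm_id (simple_id sX)) mulr1 ger0_norm.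
Qed.

End Norms.

Section SimpleDuals.
Context {R : realType} {C : rigidCstarTensorCat R} (S : choices C).
Local Notation I := (Irr S).
Local Notation X_ := (rep (c := S)).
Local Notation "k ^b" := (bar k) (at level 2, format "k ^b").
Local Notation o := (irr0 S).
Implicit Types (k l m n : I) (Y Z : C).

Lemma conjugate_recast (X Y Y' : C) (e : Y = Y') (r : Hom 𝟙 (Y ⊗ X)) (rb : Hom 𝟙 (X ⊗ Y)) :
  conjugate_eqs r rb ->
  conjugate_eqs (recast r erefl (congr1 (fun Z => Z ⊗ X) e))
                (recast rb erefl (congr1 (fun Z => X ⊗ Z) e)).
Proof. by case: _ / e. Qed.

Lemma rep_conj k : conjugate_eqs (Rk k) (Rbk k).
Proof. exact: conjugate_recast (sol_conj S (X_ k)). Qed.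

Lemma rep_conj_bar k : conjugate_eqs (Rbk k) (Rk k).
Proof. exact: conjugate_sym (rep_conj k). Qed.

Definition qdim k : R[i] := (sdim S (X_ k))%:C.

(** Standardness at the identity equates the two loops; [sdim] is then their common value. *)
Lemma nrm_sol k : nrm (sol S (X_ k)) = nrm (solb S (X_ k)).
Proof.
have := sol_standard S (idm (X_ k)); rewrite !thom1 !compm1 !star_comp_nrm; try exact: unit_simple.
move/eqP; rewrite -subr_eq0 -scalerBl scaler_eq0 => /orP[|/eqP/(simple_id (unit_simple C)) //].
rewrite subr_eq0 => /eqP [] /eqP; rewrite eqrXn2 ?nrm_ge0 // => /eqP //.
Qed.

Lemma sol_norm k : comp (star (sol S (X_ k))) (sol S (X_ k)) = qdim k *: idm 𝟙.
Proof.
rewrite star_comp_nrm; last exact: unit_simple.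
by rewrite /qdim /sdim -nrm_sol -expr2.
Qed.

Lemma solb_norm k : comp (star (solb S (X_ k))) (solb S (X_ k)) = qdim k *: idm 𝟙.
Proof.
rewrite star_comp_nrm; last exact: unit_simple.
by rewrite /qdim /sdim nrm_sol -expr2.
Qed.

Lemma Rk_norm k : comp (star (Rk k)) (Rk k) = qdim k *: idm 𝟙.
Proof.
rewrite -sol_norm; apply: (@Arr_inj _ C); rewrite !Arr_comp !Arr_star.
by rewrite [Arr (Rk k)]Arr_recast.
Qed.
Lemma Rbk_norm k : comp (star (Rbk k)) (Rbk k) = qdim k *: idm 𝟙.
Proof.
rewrite -solb_norm; apply: (@Arr_inj _ C); rewrite !Arr_comp !Arr_star.
by rewrite [Arr (Rbk k)]Arr_recast.
Qed.

Lemma Rbk_neq0 k : Rbk k <> 0.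
Proof.
move=> e; apply: (simple_id (rep_simple k)).
have /(congr1 (typed (X_ k) (X_ k))) := zigX (rep_conj k).
by rewrite e typed_Arr /acomp /= star0 thom0l comp0m typed_zero.
Qed.

Lemma qdim_gt0 k : 0 < qdim k.
Proof.
rewrite lt_neqAle; apply/andP; split; last first.
  by rewrite /qdim /sdim lecR mulr_ge0 ?nrm_ge0.
apply/eqP => e; apply: (@Rbk_neq0 k); apply: starcomp_eq0.
by rewrite Rbk_norm -e scale0r.
Qed.

(** [X_k] and [X_{bar (bar k)}] are both conjugate to [X_{bar k}]. Comparing the evaluations gives a
    morphism between them, nonzero because [Rbk k] is. *)
Lemma barK : involutive (@bar R C S).
Proof.
move=> k; apply: contrapT => kk.
have [t et] := eval_factor (rep_conj k^b) (star (Rbk k)).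
have t0 : t = 0 by apply: schur_rep => e; apply: kk.
apply: (@Rbk_neq0 k); apply: star_inj; rewrite star0.
apply: (@Arr_inj _ C); rewrite et t0 -Arr_id -Arr_thom thom0l.
by rewrite -Arr_star -Arr_comp compm0.
Qed.

End SimpleDuals.

(** * The tube algebra *)

Section Tube.
Context {R : realType} {C : rigidCstarTensorCat R} (S : choices C).
Local Notation I := (Irr S).
Local Notation X_ := (rep (c := S)).
Local Notation "k ^b" := (bar k) (at level 2, format "k ^b").
Local Notation o := (irr0 S).
Implicit Types (i j k l m n : I) (Y Z : C).
Variable phi : I -> R[i].

Definition normalized k : R[i] := phi k / qdim k.
Local Notation G := (Gsum normalized).

Lemma mixtr_Gsum k1 k2 (M : Hom (X_ k1 ⊗ X_ k2^b) (X_ k1 ⊗ X_ k2^b)) (L : seq I) :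
  uniq L -> (forall k (f : Hom (X_ k) (X_ k1 ⊗ X_ k2^b)), k \notin L -> f = 0) ->
  mixtr (Rk k1) (Rk k2) (Arr (comp (G _) M)) =
  ascale (\sum_(k <- L) phi k *
    \sum_(V <- onb k (X_ k1 ⊗ X_ k2^b)) scalar_of (comp (star V) (comp M V))) (aid 𝟙).
Proof.
move=> uL cov.
have [ms [mslin msE]] : exists ms : Hom (X_ k1 ⊗ X_ k2^b) (X_ k1 ⊗ X_ k2^b) -> Hom 𝟙 𝟙,
    linear ms /\ forall N, mixtr (Rk k1) (Rk k2) (Arr N) = Arr (ms N).
  exists (fun N => typed 𝟙 𝟙 (mixtr (Rk k1) (Rk k2) (Arr N))); split.
    by apply: linear_typed; rewrite /mixtr; alin.
  by move=> N; rewrite Arr_typed /mixtr /= ?tob1l.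
rewrite msE (GsumE _ uL cov) comp_suml (lin_sum mslin) -Arr_id -Arr_scale; congr Arr.
rewrite scaler_suml; apply: eq_bigr => k _.
rewrite compZl (lin_scale mslin) comp_suml (lin_sum mslin) mulr_sumr scaler_suml scaler_sumr.
apply: eq_bigr => V _; apply: (@Arr_inj _ C).
(* The term is read as [V star V'] with [V' = star M V], the shape to which [mixed_trace]
   applies. *)
rewrite [LHS]Arr_scale -msE -compA -[comp (star V) M]starK.
rewrite (mixed_trace (rep_conj_bar k1) (rep_conj_bar k2) (rep_simple _) (rep_simple _)
  (Rbk_norm _) (Rk_norm _) (Rbk_norm _) (Rk_norm _) _ _ (rep_conj k) (rep_simple _) (rep_simple _)
  (lt0r_neq0 (qdim_gt0 k)) (Rk_norm k) (Rbk_norm k)).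
rewrite starK -compA /ascale /= scalerA mulrA /normalized divfK //.
exact: lt0r_neq0 (qdim_gt0 k).
Qed.

(** [X_{bar k1}] plays the role of [X1] and [X_{k1}] that of [Y1]: the strand carrying the bent
    adjoint is then [X_{k1}], as in the involution. *)
Definition cup_pair k1 k2 : Hom (X_ k2^b ⊗ X_ k2) (X_ k1^b ⊗ X_ k1) :=
  @cup_twist _ _ _ _ _ _ (Rbk k1) (Rk k1) (Rk k2) G.

Definition cup_vector m k (F : Hom (X_ k^b) (X_ m ⊗ X_ k^b)) :
    Hom 𝟙 (X_ m ⊗ (X_ k^b ⊗ X_ k)) :=
  typed _ _ ((Arr F ⊙ aid (X_ k)) • Arr (Rk k)).

Definition cup_form m k1 k2 (h1 : Hom 𝟙 (X_ m ⊗ (X_ k1^b ⊗ X_ k1)))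
    (h2 : Hom 𝟙 (X_ m ⊗ (X_ k2^b ⊗ X_ k2))) : R[i] :=
  scalar_of (comp (star h1) (comp (idm (X_ m) ⊠ cup_pair k1 k2) h2)).

Lemma Arr_cup_vector m k F : Arr (@cup_vector m k F) = (Arr F ⊙ aid (X_ k)) • Arr (Rk k).
Proof. by rewrite Arr_typed //; obj. Qed.

Definition bent_pair m k1 k2 (F1 : Hom (X_ k1^b) (X_ m ⊗ X_ k1^b))
    (F2 : Hom (X_ k2^b) (X_ m ⊗ X_ k2^b)) : Hom (X_ k1 ⊗ X_ k2^b) (X_ k1 ⊗ X_ k2^b) :=
  typed _ _ ((bent (r1 := Rbk k1) (rb1 := Rk k1) F1 ⊙ aid (X_ k2^b)) • (aid (X_ k1) ⊙ Arr F2)).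

Lemma Arr_bent_pair m k1 k2 F1 F2 : Arr (@bent_pair m k1 k2 F1 F2) =
  (bent (r1 := Rbk k1) (rb1 := Rk k1) F1 ⊙ aid (X_ k2^b)) • (aid (X_ k1) ⊙ Arr F2).
Proof. by rewrite Arr_typed // /bent; obj. Qed.

Lemma cup_form_sum m k1 k2 (F1 : Hom (X_ k1^b) (X_ m ⊗ X_ k1^b))
    (F2 : Hom (X_ k2^b) (X_ m ⊗ X_ k2^b)) (L : seq I) :
  uniq L -> (forall k (f : Hom (X_ k) (X_ k1 ⊗ X_ k2^b)), k \notin L -> f = 0) ->
  cup_form (cup_vector F1) (cup_vector F2) =
  \sum_(k <- L) phi k *
    \sum_(V <- onb k (X_ k1 ⊗ X_ k2^b)) scalar_of (comp (star V) (comp (bent_pair F1 F2) V)).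
Proof.
move=> uL cov; rewrite /cup_form -[RHS](scalar_ofZ _ (unit_simple C)); congr scalar_of.
apply: (@Arr_inj _ C); rewrite Arr_scale Arr_id -mixtr_Gsum //.
rewrite !ArrE !Arr_cup_vector Arr_bent_pair acompA.
exact: (cup_twist_trace (rep_conj_bar k1)).
Qed.

Lemma recast0 (X Y X' Y' : C) (e : X = X') (e' : Y = Y') :
  recast (0 : Hom X Y) e e' = 0.
Proof. by case: _ / e; case: _ / e'. Qed.

Lemma aid0 : aid (X_ o) = aid 𝟙.
Proof. by rewrite rep0. Qed.

Lemma Arr_tube_id k : Arr (tube_id k) = aid (X_ k).
Proof. exact: Arr_recast. Qed.
Lemma Arr_fusion_basis k : Arr (@fusion_basis _ _ S k) = aid (X_ k).
Proof. exact: Arr_recast. Qed.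

Lemma fusion_coord k (x : tubeHom o o k) c :
  Arr x = ascale c (aid (X_ k)) -> coord [tuple fusion_basis k] ord0 x = c.
Proof.
rewrite -Arr_fusion_basis => /Arr_inj ->; rewrite linearZ /=.
rewrite [X in coord _ _ X](_ : _ = [tuple @fusion_basis _ _ S k]`_(ord0 : 'I_1)) //.
rewrite coord_free ?eqxx ?mulr1 // seq1_free; apply/eqP => e.
apply: (simple_id (rep_simple k)); rewrite -[LHS]typed_Arr Arr_id -Arr_fusion_basis e.
exact: typed_zero.
Qed.

(* The involution pairs the strand [X_k] with the component of [f] at [bar k]. *)
Definition leg m (f : family S) k : Hom (X_ k^b) (X_ m ⊗ X_ k^b) :=
  typed _ _ (Arr (f o m k^b)).

Lemma Arr_leg m (f : family S) k : Arr (leg m f k) = Arr (f o m k^b).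
Proof. by rewrite Arr_typed //= rep0 tob1r. Qed.

Lemma Arr_tube_inv m (f : family S) k :
  Arr (tube_inv f m o k) = bent (r1 := Rbk k) (rb1 := Rk k) (leg m f k).
Proof.
by rewrite /tube_inv /bent !ArrE aid0 aten1r Arr_leg !atenA.
Qed.

(** [x] stands for a summand of [tube_mul] and is specified only as an arrow, so that its strictness
    casts drop out. *)
Lemma tube_term m (f : family S) k1 k2 k (V : Hom (X_ k) (X_ k1 ⊗ X_ k2^b)) c
    (x : tubeHom o o k) :
  c = scalar_of (comp (star V) (comp (bent_pair (leg m f k1) (leg m f k2)) V)) ->
  Arr x = (aid (X_ o) ⊙ (Arr V)^*) • (Arr (tube_inv f m o k1) ⊙ aid (X_ k2^b)) •
      (aid (X_ k1) ⊙ Arr (f o m k2^b)) • (Arr V ⊙ aid (X_ o)) ->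
  coord [tuple fusion_basis k] ord0 x = c.
Proof.
move=> -> ex; apply: fusion_coord; rewrite ex aid0 aten1l aten1r Arr_tube_inv -Arr_leg.
rewrite -Arr_scalar ?Arr_comp ?Arr_bent_pair ?acompA //; exact: rep_simple.
Qed.

Section InvolutionTerms.
Variables (m : I) (f : family S) (K : seq I).
Hypotheses (fm : in_block o m f) (uK : uniq K) (fK : forall k, k \notin K -> f o m k^b = 0).

Lemma tube_inv0 k : k \notin K -> tube_inv f m o k = 0.
Proof.
move=> kK; rewrite /tube_inv fK // star0 thom0r thom0l.
by rewrite !(recast0, compm0, comp0m).
Qed.

Lemma tube_mul_coord k :
  coord [tuple fusion_basis k] ord0 (tube_mul (tube_inv f) f o o k) =
  \sum_(k1 <- K) \sum_(k2 <- K) \sum_(V <- onb k (X_ k1 ⊗ X_ k2^b))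
    scalar_of (comp (star V) (comp (bent_pair (leg m f k1) (leg m f k2)) V)).
Proof.
(* As [f] lies in A_{0,m}, a triple contributes only if its intermediate object is [X_m] and both
   strands meet the support, which [K] lists through [bar]. *)
rewrite /tube_mul (fsbigT_seq (r := [seq (m, k1, k2^b) | k1 <- K, k2 <- K])).
- rewrite linear_sum big_allpairs_dep; apply: eq_bigr => k1 _; apply: eq_bigr => k2 _.
  rewrite linear_sum; apply: eq_bigr => V _; apply: tube_term => //.
  by rewrite !ArrE.
- apply: allpairs_uniq => // -[a b] [a' b'] _ _ /= [-> /(inv_inj (@barK _ _ S))->] //.
move=> [[s k1] l] notin; rewrite big1 // => V _.
have [sm|sm] := eqVneq s m; last first.
  rewrite [f o s l](fm.2 o s l) ?thom0r ?recast0 ?compm0 ?comp0m //.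
  by apply: contraNneq sm => -[->].
subst s; have [k1K|k1K] := boolP (k1 \in K); last first.
  by rewrite tube_inv0 // thom0l !(recast0, compm0, comp0m).
have [lK|lK] := boolP (l^b \in K); last first.
  have -> : f o m l = 0 by rewrite -[l]barK fK.
  by rewrite thom0r !(recast0, compm0, comp0m).
case/negP: notin; apply/allpairsP; exists (k1, l^b); split=> //=; by rewrite barK.
Qed.

Lemma fusion_functional_square :
  fusion_functional phi (tube_mul (tube_inv f) f o o) =
  \sum_(k1 <- K) \sum_(k2 <- K) cup_form (cup_vector (leg m f k1)) (cup_vector (leg m f k2)).
Proof.
have [L [uL cov]] := finite_support_seq S (fun t : I * I => X_ t.1 ⊗ X_ t.2^b)
  [seq (k1, k2) | k1 <- K, k2 <- K].
have covK k1 k2 : k1 \in K -> k2 \in K ->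
    forall k (g : Hom (X_ k) (X_ k1 ⊗ X_ k2^b)), k \notin L -> g = 0.
  move=> h1 h2 k g; apply: (cov (k1, k2)); apply/allpairsP; by exists (k1, k2).
rewrite /fusion_functional (fsbigT_seq uL); last first.
  move=> k kL; rewrite tube_mul_coord big_seq big1 ?mulr0 // => k1 h1.
  rewrite big_seq big1 // => k2 h2; rewrite big1 // => V _.
  by rewrite (covK _ _ h1 h2 k V kL) compm0 compm0 /scalar_of linear0.
under eq_bigr => k _ do rewrite tube_mul_coord mulr_sumr.
rewrite exchange_big /=; apply: eq_big_seq => k1 h1.
under eq_bigr => k _ do rewrite mulr_sumr.
rewrite exchange_big /=; apply: eq_big_seq => k2 h2.
by rewrite (cup_form_sum _ _ uL (covK _ _ h1 h2)).
Qed.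

End InvolutionTerms.

End Tube.

(** * Annular states and admissible states *)

Section Forward.
Context {R : realType} {C : rigidCstarTensorCat R} (S : choices C).
Local Notation I := (Irr S).
Local Notation X_ := (rep (c := S)).
Local Notation "k ^b" := (bar k) (at level 2, format "k ^b").
Local Notation o := (irr0 S).
Implicit Types (i j k l m n : I) (Y Z : C).
Variable phi : I -> R[i].
Local Notation G := (Gsum (normalized phi)).

Lemma thom_idl_comp (A X Y Z : C) (g : Hom Y Z) (f : Hom X Y) :
  comp (idm A ⊠ g) (idm A ⊠ f) = idm A ⊠ comp g f.
Proof. by rewrite -thom_comp comp1m. Qed.

(** Closing an endomorphism of [X_n] with [Rk n] multiplies its scalar by the loop value
    [qdim n]. *)
Lemma cup_form_conj n k1 k2 (x1 : Hom (X_ n) (X_ k1^b ⊗ X_ k1))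
    (x2 : Hom (X_ n) (X_ k2^b ⊗ X_ k2)) :
  cup_form phi (comp (idm (X_ n^b) ⊠ x1) (Rk n)) (comp (idm (X_ n^b) ⊠ x2) (Rk n)) =
  scalar_of (comp (star x1) (comp (cup_pair phi k1 k2) x2)) * qdim n.
Proof.
rewrite /cup_form star_comp thom_star star1 -compA !(compA (idm _ ⊠ _)) !thom_idl_comp.
rewrite (compA (idm _ ⊠ _)) thom_idl_comp -(compA (star x1)).
set M := comp (star x1) _.
rewrite (scalar_ofE M (rep_simple n)) thomZr thom1 compZl comp1m compZr Rk_norm scalerA.
rewrite scalar_ofZ; last exact: unit_simple.
by rewrite scalar_ofZ //; exact: rep_simple.
Qed.

Section Annular.
Hypothesis ann : weight0_annular_state (fusion_functional phi).

(** Morphisms out of [X_n] become vectors [h k] with an extra factor [X_{bar n}], and unbending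
    these gives the legs of an element of A_{0,bar n}. Its annular positivity is the claim
    multiplied by [qdim n > 0]. *)
Lemma cup_pair_psd n (K : seq I) (x : forall k, Hom (X_ n) (X_ k^b ⊗ X_ k)) : uniq K ->
  0 <= \sum_(k1 <- K) \sum_(k2 <- K)
    scalar_of (comp (star (x k1)) (comp (cup_pair phi k1 k2) (x k2))).
Proof.
move=> uK; pose m := n^b; pose h k := comp (idm (X_ m) ⊠ x k) (Rk n).
pose F k : Hom (X_ k^b) (X_ m ⊗ X_ k^b) :=
  typed _ _ (unbend (Rbk k) (X_ m ⊗ X_ k^b) (Arr (h k))).
have ArrF k : Arr (F k) = unbend (Rbk k) (X_ m ⊗ X_ k^b) (Arr (h k)).
  by rewrite Arr_typed //; obj.
have hF k : cup_vector (F k) = h k.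
  apply: (@Arr_inj _ C); rewrite Arr_cup_vector.
  rewrite -(unbendK (rep_conj_bar k) (b := X_ m ⊗ X_ k^b) (c := 𝟙) (t := Arr (h k))) //; last obj.
  by rewrite -ArrF bend.unlock aten1l.
(* The component at [l] is [F] at [bar l], because the leg at [k] is read off at [bar k]. *)
pose f : family S := fun i j l =>
  if [&& i == o, j == m & l^b \in K] then typed _ _ (Arr (F l^b)) else 0.
have Arrf k : k \in K -> Arr (f o m k^b) = Arr (F k).
  move=> kK; rewrite /f !eqxx barK kK /= Arr_typed //= ?barK // rep0 tob1r //.
have f0 k : k \notin K -> f o m k^b = 0.
  by move=> kK; rewrite /f !eqxx barK (negPf kK).
have fb : in_block o m f.
  split.
    apply: (sub_finite_set (B := [set` map (@bar _ _ S) K]%classic)); last exact: finite_seq.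
    move=> l /= lf; apply/mapP; exists l^b; last by rewrite barK.
    by apply: contraNT lf => lK; rewrite -[l]barK f0.
  move=> i j l ij; rewrite /f; case: eqP => // io; case: eqP => //= jm.
  by rewrite io jm eqxx in ij.
have legF k : k \in K -> leg m f k = F k.
  by move=> kK; apply: (@Arr_inj _ C); rewrite Arr_leg Arrf.
have [_ _ /(_ m f fb)] := ann.
rewrite (fusion_functional_square phi fb uK f0).
under eq_big_seq => k1 h1 do under eq_big_seq => k2 h2 do
  rewrite !legF // !hF cup_form_conj.
under eq_bigr => k1 _ do rewrite -mulr_suml.
by rewrite -mulr_suml pmulr_lge0 // qdim_gt0.
Qed.

(** The pairs are the blocks of one endomorphism [T] of a direct sum. [psd_square] tests [T] on
    simple objects only, where [cup_pair_psd] applies, and the root restricted to the summands gives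
    the [e k]. *)
Lemma cup_pair_square (K : seq I) : uniq K ->
  exists (Z : C) (e : forall k, Hom (X_ k^b ⊗ X_ k) Z),
  forall k1 k2, k1 \in K -> k2 \in K -> cup_pair phi k1 k2 = comp (star (e k1)) (e k2).
Proof.
move=> uK; have [Y [u [ui uo _]]] := direct_sum (fun k => X_ k^b ⊗ X_ k) uK.
pose T := \sum_(k1 <- K) \sum_(k2 <- K) comp (u k1) (comp (cup_pair phi k1 k2) (star (u k2))).
have [n f|g Tg] := @psd_square _ _ S Y T.
  have := cup_pair_psd (fun k => comp (star (u k)) f) uK.
  suff -> : \sum_(k1 <- K) \sum_(k2 <- K) scalar_of (comp (star (comp (star (u k1)) f))
      (comp (cup_pair phi k1 k2) (comp (star (u k2)) f))) =
    scalar_of (comp (star f) (comp T f)) by [].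
  rewrite comp_suml comp_sumr /scalar_of linear_sum; apply: eq_bigr => k1 _.
  rewrite comp_suml comp_sumr linear_sum; apply: eq_bigr => k2 _.
  by rewrite star_comp starK !compA.
exists Y, (fun k => comp g (u k)) => k1 k2 h1 h2.
rewrite star_comp -compA (compA (star g)) -Tg.
rewrite comp_suml comp_sumr (bigD1_seq k1) //= [X in _ + X]big1_seq ?addr0; last first.
  move=> k /andP[/eqP kk1 kK]; rewrite comp_suml comp_sumr big1_seq // => l _.
  rewrite -compA (compA (star (u k1))) uo ?comp0m //; exact/nesym.
rewrite comp_suml comp_sumr (bigD1_seq k2) //= big1_seq ?addr0; last first.
  move=> k /andP[/eqP kk2 kK]; rewrite -!compA [comp (star (u k)) _]uo //.
  by rewrite !compm0.
rewrite -compA (compA (star (u k1))) ui // comp1m -compA ui // compm1 //.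
Qed.

(** Simple summands are indexed through [bar] because [cup_pair] has [X_{bar k}] as left factor;
    [barK] reaches every class this way. *)
Lemma bar_decomposition (a : C) : exists s : seq {k : I & Hom (X_ k^b) a},
  idm a = \sum_(t <- s) comp (projT2 t) (star (projT2 t)).
Proof.
have [L [uL cov]] := finite_support_uniq S a.
pose tr l (V : Hom (X_ l) a) := typed (X_ l^b^b) a (Arr V).
exists (flatten [seq [seq existT (fun k => Hom (X_ k^b) a) l^b (tr l V) | V <- onb l a] | l <- L]).
rewrite big_flatten big_map (decomposition uL cov); apply: eq_bigr => l _.
rewrite big_map; apply: eq_bigr => V _ /=; apply: (@Arr_inj _ C).
by rewrite !Arr_comp !Arr_star /tr Arr_typed //= barK.
Qed.

(** Splitting [idm a] on both sides of [star v v'] isolates [Rk k star (Rk k')] in the middle.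
    [twist_natural] pulls everything else out of Theta, and the middle becomes [cup_pair], which is
    a square. *)
Lemma annular_Theta_cp (a b : C) : completely_positive (@Theta _ _ S (normalized phi) a b).
Proof.
move=> n x [y xy]; have Gnat := Gsum_nat (normalized phi).
have [s sE] := bar_decomposition a.
pose K := undup (map (fun t => projT1 t) s).
have sK t : t \in s -> projT1 t \in K by move=> ts; rewrite mem_undup map_f.
have [Z [e eK]] := cup_pair_square (undup_uniq (map (fun t => projT1 t) s)).
pose g := a ⊗ b.
(* The Frobenius transpose of [v] restricted to the summand [t] of [a]; [zE] recovers the
   restriction. *)
pose z (v : Hom g g) (t : {k : I & Hom (X_ k^b) a}) : Hom b (X_ (projT1 t) ⊗ g) :=
  typed _ _ (sharp (Rbk (projT1 t)) b (Arr v • (Arr (projT2 t) ⊙ aid b))).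
have zE v t : ((Arr (Rk (projT1 t)))^* ⊙ aid g) • (aid (X_ (projT1 t)^b) ⊙ Arr (z v t)) =
    Arr v • (Arr (projT2 t) ⊙ aid b).
  rewrite /z Arr_typed; try obj.
  by rewrite -[RHS](sharpK (rep_conj (projT1 t)) (b := g) (c := b)) // flat.unlock.
(* The part that stays inside Theta: a cap followed by a cup, with [g] as an idle right factor that
   [twist_tenr] removes. *)
pose P k k' : Hom (X_ k'^b ⊗ (X_ k' ⊗ g)) (X_ k^b ⊗ (X_ k ⊗ g)) :=
  typed _ _ (Arr (comp (Rk k) (star (Rk k'))) ⊙ aid g).
have ArrP k k' : Arr (P k k') = Arr (comp (Rk k) (star (Rk k'))) ⊙ aid g.
  by rewrite Arr_typed; try obj.
pose h (v : Hom g g) (t : {k : I & Hom (X_ k^b) a}) : Hom g (Z ⊗ g) :=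
  typed _ _ ((Arr (e (projT1 t)) ⊙ aid g) • ((Arr (projT2 t))^* ⊙ Arr (z v t))).
have Arrh v t : Arr (h v t) =
    (Arr (e (projT1 t)) ⊙ aid g) • ((Arr (projT2 t))^* ⊙ Arr (z v t)).
  by rewrite Arr_typed; try obj.
have term v v' t t' : t \in s -> t' \in s ->
    Theta (normalized phi) (comp (comp (comp (projT2 t) (star (projT2 t)) ⊠ idm b)
      (comp (star v) v')) (comp (projT2 t') (star (projT2 t')) ⊠ idm b)) =
    comp (star (h v t)) (h v' t').
  move=> ts ts'.
  have -> : comp (comp (comp (projT2 t) (star (projT2 t)) ⊠ idm b)
      (comp (star v) v')) (comp (projT2 t') (star (projT2 t')) ⊠ idm b) =
    comp (comp (projT2 t ⊠ star (z v t)) (P (projT1 t) (projT1 t')))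
      (star (projT2 t') ⊠ z v' t').
    apply: (@Arr_inj _ C); rewrite !Arr_comp !Arr_thom ArrP !Arr_comp.
    rewrite !Arr_star !Arr_id !whiskr // [_ ⊙ (Arr (z v t))^*]aten_l [_ ⊙ Arr (z v' t')]aten_r /= -!acompA.
    rewrite (acompA ((Arr (Rk (projT1 t')))^* ⊙ aid g)) zE.
    have /(congr1 astar) := zE v t; rewrite !astarE => e1.
    by rewrite (acompA (aid _ ⊙ (Arr (z v t))^*)) e1 -!acompA.
  rewrite ThetaE (twist_natural Gnat (rep_conj_bar _) (sol_conj S a)).
  apply: (@Arr_inj _ C); rewrite !Arr_comp.
  rewrite (twist_tenr _ (rep_conj_bar _) (ArrP _ _)) -[twist _ _ _ _]/(cup_pair phi _ _).
  rewrite eK ?sK // !ArrE !Arrh !astarE.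
  by rewrite whiskr // !acompA.
(* One square for each row [p] of the factor [y] of [x]. *)
pose ss := [seq existT (fun Y : C => 'I_n -> Hom g Y) (Z ⊗ g)
   (fun q => \sum_(t <- s) h (y p q) t) | p <- index_enum 'I_n].
apply: (@sum_squares_mx_positive _ _ g n (fun p q => Theta (normalized phi) (x p q)) ss) => i j.
have [Tlin _ _] := Theta_multiplier (normalized phi).
rewrite big_map xy (lin_sum (Tlin a b)); apply: eq_bigr => p _ /=.
rewrite star_sum comp_suml -[comp _ _ in LHS]compm1 -[comp (star _) (y p j)]comp1m -thom1 sE.
rewrite thom_suml !comp_suml (lin_sum (Tlin a b)).
apply: eq_big_seq => t ts; rewrite comp_sumr (lin_sum (Tlin a b)) comp_sumr.
by apply: eq_big_seq => t' ts'; apply: term.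
Qed.

End Annular.
End Forward.

(** * From cp-multipliers to annular states *)

Section Backward.
Context {R : realType} {C : rigidCstarTensorCat R} (S : choices C).
Local Notation I := (Irr S).
Local Notation X_ := (rep (c := S)).
Local Notation "k ^b" := (bar k) (at level 2, format "k ^b").
Local Notation o := (irr0 S).
Implicit Types (k l m : I).
Variable phi : I -> R[i].

Lemma fusion_functional_linear (c : R[i]) (x y : forall k, tubeHom o o k) :
  finite_set [set k | x k != 0]%classic -> finite_set [set k | y k != 0]%classic ->
  fusion_functional phi (fun k => c *: x k + y k) =
  c * fusion_functional phi x + fusion_functional phi y.
Proof.
move=> /finite_seqP[A eA] /finite_seqP[B eB].
pose L := undup (A ++ B); have uL : uniq L by apply: undup_uniq.
have xL k : k \notin L -> x k = 0.
  rewrite mem_undup mem_cat negb_or => /andP[kA _]; apply/eqP; apply: contraNT kA => h.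
  by have : [set k | x k != 0]%classic k by []; rewrite eA.
have yL k : k \notin L -> y k = 0.
  rewrite mem_undup mem_cat negb_or => /andP[_ kB]; apply/eqP; apply: contraNT kB => h.
  by have : [set k | y k != 0]%classic k by []; rewrite eB.
rewrite /fusion_functional !(fsbigT_seq uL); last first.
- by move=> k kL; rewrite xL // yL // scaler0 addr0 linear0 mulr0.
- by move=> k kL; rewrite xL // linear0 mulr0.
- by move=> k kL; rewrite yL // linear0 mulr0.
rewrite mulr_sumr -big_split /=; apply: eq_bigr => k _.
by rewrite linearP mulrDr mulrCA.
Qed.

Lemma fusion_functional_unit : fusion_functional phi (tube_proj o o o) = phi o.
Proof.
rewrite /fusion_functional (fsbigT_seq (r := [:: o])) //.
  rewrite big_seq1 /tube_proj dfwith_in (@fusion_coord _ _ S o _ 1) ?mulr1 //.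
  by rewrite Arr_tube_id /ascale scale1r.
move=> k; rewrite inE => ko; rewrite /tube_proj dfwith_out ?linear0 ?mulr0 //.
by rewrite eq_sym; apply: contraNneq ko => -[->].
Qed.

(** Direct sums over the support of [f] put all pairs into one positive element. Theta of it is a
    square whose blocks are the [cup_pair]s, so the double sum is the squared length of the single
    vector obtained by adding the [v k]. *)
Lemma cp_annular : (forall a b, completely_positive (@Theta _ _ S (normalized phi) a b)) ->
  forall m f, in_block o m f -> 0 <= fusion_functional phi (tube_mul (tube_inv f) f o o).
Proof.
move=> cp m f fb.
have /finite_seqP[A eA] := fb.1.
pose K := undup (map (@bar _ _ S) A); have uK : uniq K by apply: undup_uniq.
have f0 k : k \notin K -> f o m k^b = 0.
  rewrite mem_undup => kK; apply/eqP; apply: contraNT kK => h.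
  have : [set k | f o m k != 0]%classic k^b by [].
  by rewrite eA => kA; rewrite -[k]barK map_f.
rewrite (fusion_functional_square phi fb uK f0).
have [a [w [wi wo _]]] := direct_sum (fun k => X_ k^b) uK.
have [b [w' [wi' wo' _]]] := direct_sum (fun k => X_ k) uK.
(* All evaluations at once: the block of [star y y] at [(k1, k2)] is [Rk k1 star (Rk k2)], the
   argument of Theta in [cup_pair]. *)
pose y := \sum_(k <- K) comp (star (Rk k)) (star (w k) ⊠ star (w' k)).
have yE k : k \in K -> comp y (w k ⊠ w' k) = star (Rk k).
  move=> kK; rewrite comp_suml (bigD1_seq k) //= -compA -thom_comp wi // wi' // thom1 compm1.
  rewrite big1_seq ?addr0 // => l /andP[/eqP lk lK].
  by rewrite -compA -thom_comp wo // thom0l compm0.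
have [g yg] := star_pos y.
have [g' tg] : exists g' : Hom (a ⊗ b) (a ⊗ b), Theta (normalized phi) (comp (star y) y) = comp (star g') g'.
  have mp : mx_positive (fun _ _ : 'I_1 => comp (star y) y).
    by exists (fun _ _ => g) => i j; rewrite big_ord1.
  have [h /(_ ord0 ord0)] := cp a b 1%N _ mp.
  by rewrite big_ord1 => ->; exists (h ord0 ord0).
have cupE k1 k2 : k1 \in K -> k2 \in K ->
    cup_pair phi k1 k2 = comp (star (comp g' (w k1 ⊠ w' k1))) (comp g' (w k2 ⊠ w' k2)).
  move=> h1 h2; rewrite /cup_pair /cup_twist.
  have -> : comp (Rk k1) (star (Rk k2)) =
      comp (comp (star (w k1) ⊠ star (w' k1)) (comp (star y) y)) (w k2 ⊠ w' k2).
    by rewrite -compA -(compA (star y)) yE // compA -thom_star -star_comp yE // starK.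
  rewrite (twist_natural (Gsum_nat _) (sol_conj S a) (rep_conj_bar k1)) -ThetaE tg.
  by rewrite star_comp thom_star !compA.
pose v k := comp (idm (X_ m) ⊠ comp g' (w k ⊠ w' k)) (cup_vector (leg m f k)).
have -> : \sum_(k1 <- K) \sum_(k2 <- K)
    cup_form phi (cup_vector (leg m f k1)) (cup_vector (leg m f k2)) =
  scalar_of (comp (star (\sum_(k <- K) v k)) (\sum_(k <- K) v k)).
  rewrite star_sum comp_suml /scalar_of linear_sum; apply: eq_big_seq => k1 h1.
  rewrite comp_sumr linear_sum; apply: eq_big_seq => k2 h2.
  have -> : star (v k1) = comp (star (cup_vector (leg m f k1)))
      (idm (X_ m) ⊠ star (comp g' (w k1 ⊠ w' k1))).
    by rewrite /v star_comp thom_star star1.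
  by rewrite /cup_form /scalar_of cupE // -thom_idl_comp /v !compA.
by apply: scalar_of_ge0; apply: unit_simple.
Qed.

End Backward.

Theorem theorem6p6 (R : realType) (C : rigidCstarTensorCat R) (S : choices C)
    (phi : Irr S -> R[i]) :
  weight0_annular_state (fusion_functional phi) <-> admissible_state phi.
Proof.
split=> [ann|[phi0 [_ cp]]].
  split; first by have [_ <- _] := ann; rewrite fusion_functional_unit.
  split; first exact: Theta_multiplier.
  by move=> a b; apply: annular_Theta_cp.
split.
- by move=> a x y [fx _] [fy _]; apply: fusion_functional_linear.
- by rewrite fusion_functional_unit.
- by move=> m f; apply: cp_annular.
Qed.
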